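(* Let $H$ be a finite simple graph containing at least one edge, with chromatic number $\chi(H)$, and fix $\beta_1\in\mathbb{R}$. For $\beta_2\in\mathbb{R}$ let $$T_{\beta_2}(h)=\beta_1\iint_{[0,1]^2}h(x,y)\,dx\,dy+\beta_2\,t(H,h),\qquad h\in\mathcal{W},$$ let $\widetilde{F}^*(\beta_2)\subseteq\widetilde{\mathcal{W}}$ be the set of points where $T_{\beta_2}-I$ attains its maximum over $\widetilde{\mathcal{W}}$, and let $\psi(\beta_2)=\sup_{h\in\mathcal{W}}(T_{\beta_2}(h)-I(h))$. Define $$g(x,y):=\begin{cases}1,&\text{if }[(\chi(H)-1)x]\ne[(\chi(H)-1)y],\\0,&\text{otherwise},\end{cases}$$ where $[x]$ denotes the integer part of a real number $x$, and let $p=e^{2\beta_1}/(1+e^{2\beta_1})$. Then $$\lim_{\beta_2\to-\infty}\ \sup_{\widetilde{f}\in\widetilde{F}^*(\beta_2)}\delta_\Box(\widetilde{f},p\widetilde{g})=0$$ and $$\lim_{\beta_2\to-\infty}\psi(\beta_2)=\frac{\chi(H)-2}{2(\chi(H)-1)}\log\frac1{1-p}.$$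
   Context: $\mathcal{W}$ is the set of all measurable functions $h:[0,1]^2\to[0,1]$ with $h(x,y)=h(y,x)$. The cut distance on $\mathcal{W}$ is $d_\Box(f,g)=\sup_{S,A\subseteq[0,1]}\left|\int_{S\times A}[f(x,y)-g(x,y)]\,dx\,dy\right|$ (supremum over measurable sets). Let $\Sigma$ be the set of measure-preserving bijections $\sigma:[0,1]\to[0,1]$ and write $g_\sigma(x,y)=g(\sigma x,\sigma y)$. For $g\in\mathcal{W}$, $\widetilde{g}$ denotes the closure in $(\mathcal{W},d_\Box)$ of the orbit $\{g_\sigma:\sigma\in\Sigma\}$; $\widetilde{\mathcal{W}}$ is the resulting quotient space, with metric $\delta_\Box(\widetilde{f},\widetilde{g})=\inf_{\sigma\in\Sigma}d_\Box(f,g_\sigma)$. $p\widetilde{g}$ denotes the class in $\widetilde{\mathcal{W}}$ of the function $pg$. For $H$ with vertex set $\{1,\dots,m\}$ and edge set $E(H)$, and $h\in\mathcal{W}$, $t(H,h)=\int_{[0,1]^m}\prod_{\{i,j\}\in E(H)}h(x_i,x_j)\,dx_1\cdots dx_m$. $I(u)=\frac12u\log u+\frac12(1-u)\log(1-u)$ for $u\in[0,1]$ ($0\log0=0$), and $I(h)=\iint_{[0,1]^2}I(h(x,y))\,dx\,dy$ for $h\in\mathcal{W}$. Both $T_{\beta_2}$ and $I$ are known to depend only on the class $\widetilde{h}$, so they are regarded as functions on $\widetilde{\mathcal{W}}$. Here $\psi(\beta_2)$ equals the limit of the normalizing constants $\psi_n=\frac1{n^2}\log\sum_Ge^{n^2T_{\beta_2}(\widetilde{G})}$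 (sum over simple graphs $G$ on $\{1,\dots,n\}$) of the exponential random graph model with sufficient statistic $T_{\beta_2}(\widetilde{G})=2\beta_1\frac{\#\text{edges in }G}{n^2}+\beta_2\,t(H,G)$, where $t(H,G)$ is the homomorphism density of $H$ in $G$. *)

(* Defs.v *)
From HB Require Import structures.
From mathcomp Require Import all_boot all_order all_algebra.
From mathcomp Require Import all_classical all_reals all_analysis.
From mathcomp Require Import measurable_realfun.
From mathcomp Require Import lra.

Set Implicit Arguments.
Unset Strict Implicit.
Unset Printing Implicit Defensive.

Import Order.TTheory GRing.Theory Num.Theory.
Import numFieldNormedType.Exports.

Local Open Scope classical_set_scope.
Local Open Scope ring_scope.

Record sgraph (m : nat) := SGraph {
  adj :> rel 'I_m;
  adj_sym : symmetric adj;
  adj_irrefl : irreflexive adj }.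

Section chromatic.
Variables (m : nat) (H : sgraph m).

Definition colorable (k : nat) : bool :=
  [exists c : {ffun 'I_m -> 'I_k},
    [forall i, [forall j, H i j ==> (c i != c j)]]].

Lemma colorable_ex : exists k, colorable k.
Proof.
exists m; apply/existsP; exists [ffun i => i].
apply/forallP => i; apply/forallP => j; apply/implyP => Hij.
by rewrite !ffunE; apply: contraTneq Hij => ->; rewrite adj_irrefl.
Qed.

Definition chromatic_number : nat := ex_minn colorable_ex.

End chromatic.

Section graphons.
Variable R : realType.

Local Notation mu := (@lebesgue_measure R).
Local Notation I01 := (`[0%R, 1%R]%classic : set R).

(* Measurability is with respect to the Borel sets.  The values outside of the
   unit square are irrelevant: nothing below depends on them. *)
Record graphon := Graphon {
  gval :> R * R -> R;
  graphon_meas : measurable_fun (I01 `*` I01) gval;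
  graphon_sym : forall x y, I01 x -> I01 y -> gval (x, y) = gval (y, x);
  graphon_itv : forall x y, I01 x -> I01 y -> 0 <= gval (x, y) <= 1 }.

Definition cut_dist (f g : graphon) : R :=
  sup [set r | exists S A : set R,
    [/\ measurable S, measurable A, S `<=` I01, A `<=` I01 &
     r = `| \int[(mu \x mu)%E]_(z in S `*` A) (f z - g z) | ] ].

(* Measure-preserving bijections of [0,1], i.e. automorphisms of the measure
   space [0,1].  The measurability of direct images is automatic for
   Borel bijections (Lusin-Souslin). *)
Record mpbij := MPBij {
  mpval :> R -> R;
  mp_bij : set_bij I01 I01 mpval;
  mp_meas : measurable_fun I01 mpval;
  mp_image : forall A, measurable A -> A `<=` I01 -> measurable (mpval @` A);
  mp_pres : forall A, measurable A -> A `<=` I01 ->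
    mu (I01 `&` mpval @^-1` A) = mu A }.

Lemma mp_itv (s : mpbij) x : I01 x -> I01 (s x).
Proof. by have [sI _ _] := mp_bij s; exact: sI. Qed.

Lemma measurable_I01 : measurable I01.
Proof. exact: measurable_itv. Qed.

Lemma measurable_sq : measurable (I01 `*` I01).
Proof. by apply: measurableX; exact: measurable_I01. Qed.

Definition mpext (s : mpbij) (x : R) : R := if x \in I01 then s x else x.

Lemma mpextE (s : mpbij) x : I01 x -> mpext s x = s x.
Proof. by move=> Ix; rewrite /mpext mem_set. Qed.

Lemma mpext_meas (s : mpbij) : measurable_fun [set: R] (mpext s).
Proof.
have mI : measurable_fun [set: R] (fun x : R => x \in I01).
  apply: (measurable_fun_bool true); rewrite setTI.
  rewrite (_ : _ @^-1` _ = I01); first exact: measurable_I01.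
  apply/seteqP; split=> x /=; first by move/set_mem.
  by move=> Ix; apply: mem_set.
apply: measurable_fun_if => //.
apply: (measurable_funS measurable_I01); last exact: mp_meas.
by move=> x [_ /= /set_mem].
Qed.

Lemma mpext_pair_meas (s : mpbij) :
  measurable_fun [set: R * R] (fun z : R * R => (mpext s z.1, mpext s z.2)).
Proof.
by apply: measurable_fun_pair; apply: measurableT_comp (mpext_meas s) _.
Qed.

Section act.
Variables (g : graphon) (s : mpbij).

Let gs (z : R * R) : R := g (s z.1, s z.2).

Let gs_meas : measurable_fun (I01 `*` I01) gs.
Proof.
apply: (eq_measurable_fun
  (g \o (fun z : R * R => (mpext s z.1, mpext s z.2)))).
  by move=> [x y] /set_mem[/= Ix Iy]; rewrite /gs !mpextE.
apply: (@measurable_comp _ _ _ _ _ _ (I01 `*` I01)).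
- exact: measurable_sq.
- move=> _ [[x y] [/= Ix Iy] <-].
  by split; rewrite /= mpextE //; exact: mp_itv.
- exact: graphon_meas.
- by apply: measurable_funTS; exact: mpext_pair_meas.
Qed.

Let gs_sym x y : I01 x -> I01 y -> gs (x, y) = gs (y, x).
Proof. by move=> Ix Iy; apply: graphon_sym; exact: mp_itv. Qed.

Let gs_itv x y : I01 x -> I01 y -> 0 <= gs (x, y) <= 1.
Proof. by move=> Ix Iy; apply: graphon_itv; exact: mp_itv. Qed.

Definition gact : graphon := Graphon gs_meas gs_sym gs_itv.

End act.

Definition orbit_closure (g : graphon) : set graphon :=
  [set f | forall e : R, 0 < e -> exists s : mpbij, cut_dist f (gact g s) < e].

Definition Wtilde := {C : set graphon | exists g, C = orbit_closure g}.

Definition cls (g : graphon) : Wtilde :=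
  exist _ (orbit_closure g) (ex_intro _ g erefl).

Definition rep (C : Wtilde) : graphon := sval (cid (svalP C)).

Lemma repK (C : Wtilde) : cls (rep C) = C.
Proof.
case: C => C hC; rewrite /cls /rep; case: cid => g /= gC.
by apply: eq_exist.
Qed.

(* The value is independent of the representatives: see [delta_box_cls]. *)
Definition delta_box (C D : Wtilde) : R :=
  inf [set cut_dist (rep C) (gact (rep D) s) | s in [set: mpbij]].

Section delta_box_well_defined.

Let sq_fin (S A : set R) : measurable S -> measurable A ->
  S `<=` I01 -> A `<=` I01 -> ((mu \x mu)%E (S `*` A) < +oo)%E.
Proof.
move=> mS mA SI AI; rewrite product_measure1E//.
have fI (B : set R) : measurable B -> B `<=` I01 -> (mu B < +oo)%E.
  move=> mB BI; apply: (@le_lt_trans _ _ (mu I01)).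
    by apply: le_measure; rewrite ?inE//; exact: measurable_I01.
  by rewrite lebesgue_measure_itv /= lte_fin ltr01 -EFinB ltry.
by apply: lte_mul_pinfty; rewrite ?ge0_fin_numE//; exact: fI.
Qed.

Let diff_meas (f g : graphon) :
  measurable_fun (I01 `*` I01) (fun z => f z - g z).
Proof. by apply: measurable_funB; exact: graphon_meas. Qed.

Let diff_int (f g : graphon) (S A : set R) : measurable S -> measurable A ->
  S `<=` I01 -> A `<=` I01 ->
  (mu \x mu)%E.-integrable (S `*` A) (EFin \o (fun z => f z - g z)).
Proof.
move=> mS mA SI AI; apply: measurable_bounded_integrable.
- exact: measurableX.
- exact: sq_fin.
- apply: (measurable_funS measurable_sq); last exact: diff_meas.
  by move=> [x y] [/= /SI ? /AI ?].
- exists 2; split; first exact: num_real.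
  move=> M M2 [x y] [/= /SI Ix /AI Iy] /=.
  have /andP[f0 f1] := graphon_itv f Ix Iy.
  have /andP[g0 g1] := graphon_itv g Ix Iy.
  by rewrite ler_norml; apply/andP; split; lra.
Qed.

Let cut_set (f g : graphon) := [set r | exists S A : set R,
    [/\ measurable S, measurable A, S `<=` I01, A `<=` I01 &
     r = `| \int[(mu \x mu)%E]_(z in S `*` A) (f z - g z) | ] ].

Let cut_ub (f g : graphon) : has_ubound (cut_set f g).
Proof.
exists (\int[(mu \x mu)%E]_(z in I01 `*` I01) `|f z - g z|).
move=> _ [S [A [mS mA SI AI ->]]].
apply: le_trans (le_normr_Rintegral _ _) _.
- exact: measurableX.
- exact: diff_int.
- rewrite /Rintegral; apply: fine_le.
  + apply: integrable_fin_num; first exact: measurableX.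
    by have := integrable_norm (diff_int f g mS mA SI AI).
  + apply: integrable_fin_num; first exact: measurable_sq.
    exact: (integrable_norm (diff_int f g measurable_I01 measurable_I01
      (@subset_refl _ _) (@subset_refl _ _))).
  + apply: ge0_subset_integral => //=.
    * exact: measurableX.
    * exact: measurable_sq.
    * apply/measurable_EFinP; apply: measurableT_comp => //.
      exact: diff_meas.
    * by move=> [x y] [/= /SI ? /AI ?].
Qed.

Lemma cut_dist_ge (f g : graphon) (S A : set R) :
  measurable S -> measurable A -> S `<=` I01 -> A `<=` I01 ->
  `| \int[(mu \x mu)%E]_(z in S `*` A) (f z - g z) | <= cut_dist f g.
Proof.
by move=> mS mA SI AI; apply: (ub_le_sup (@cut_ub f g)); exists S, A.
Qed.

Lemma cut_dist_le (f g : graphon) (c : R) :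
  (forall S A : set R,
    measurable S -> measurable A -> S `<=` I01 -> A `<=` I01 ->
    `| \int[(mu \x mu)%E]_(z in S `*` A) (f z - g z) | <= c) ->
  cut_dist f g <= c.
Proof.
move=> fgc; apply: ge_sup; last by move=> _ [S [A [mS mA SI AI ->]]]; exact: fgc.
exists `| \int[(mu \x mu)%E]_(z in set0 `*` set0) (f z - g z) |.
by exists set0, set0; split.
Qed.

Lemma cut_dist_ge0 (f g : graphon) : 0 <= cut_dist f g.
Proof.
by apply: le_trans (@cut_dist_ge f g set0 set0 _ _ _ _).
Qed.

Lemma cut_dist_triangle (g f h : graphon) :
  cut_dist f h <= cut_dist f g + cut_dist g h.
Proof.
apply: cut_dist_le => S A mS mA SI AI.
apply: le_trans (lerD (cut_dist_ge f g mS mA SI AI) (cut_dist_ge g h mS mA SI AI)).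
have -> : \int[(mu \x mu)%E]_(z in S `*` A) (f z - h z) =
    \int[(mu \x mu)%E]_(z in S `*` A) ((f z - g z) + (g z - h z)).
  by apply: eq_Rintegral => z _; rewrite addrA subrK.
by rewrite RintegralD; [exact: ler_normD|exact: measurableX|exact: diff_int..].
Qed.

Lemma cut_distC (f g : graphon) : cut_dist f g = cut_dist g f.
Proof.
suff le f' g' : cut_dist f' g' <= cut_dist g' f'.
  by apply/eqP; rewrite eq_le !le.
apply: cut_dist_le => S A mS mA SI AI.
apply: le_trans (cut_dist_ge g' f' mS mA SI AI).
rewrite -normrN -mulN1r -RintegralZl; [|exact: measurableX|exact: diff_int].
rewrite le_eqVlt; apply/orP; left; apply/eqP; congr `| _ |.
by apply: eq_Rintegral => z _; lra.
Qed.

Let preimI (s : mpbij) B : mpext s @^-1` B =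
  (I01 `&` s @^-1` (B `&` I01)) `|` (B `\` I01).
Proof.
apply/seteqP; split=> x /=.
- rewrite /mpext; case: ifPn => [/set_mem Ix Bsx|nIx Bx].
    by left; split=> //; split=> //; exact: mp_itv.
  by right; split=> //; move/mem_set; exact/negP.
- case=> [[Ix [Bsx _]]|[Bx nIx]]; first by rewrite mpextE.
  by rewrite /= /mpext memNset.
Qed.

Let mpext_pres (s : mpbij) B : measurable B -> mu (mpext s @^-1` B) = mu B.
Proof.
move=> mB; have mBI : measurable (B `&` I01).
  by apply: measurableI => //; exact: measurable_I01.
have mBD : measurable (B `\` I01).
  by apply: measurableD => //; exact: measurable_I01.
rewrite preimI measureU//.
- transitivity (mu (B `&` I01) + mu (B `\` I01))%E.
    by congr (_ + _)%E; apply: mp_pres => // x [].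
  rewrite -measureU//; first by rewrite setUIDK.
  by apply/seteqP; split=> x // [[_ Ix] [_ nIx]].
- by apply: mp_meas => //; exact: measurable_I01.
- by apply/seteqP; split=> x // [[Ix _] [_ nIx]].
Qed.

Let RR := (measurableTypeR R * measurableTypeR R)%type.

Let phi (s : mpbij) (z : RR) : RR := (mpext s z.1, mpext s z.2).

Let phi_meas (s : mpbij) : measurable_fun [set: RR] (phi s) :=
  mpext_pair_meas s.

Let phi_mu (s : mpbij) : {measure set RR -> \bar R} :=
  measure_function_pushforward__canonical__measure_function_Measure
    (mu \x mu)%E (phi_meas s).

Let phi_pres (s : mpbij) (X : set RR) : measurable X ->
  (mu \x mu)%E X = phi_mu s X.
Proof.
apply: product_measure_unique => A B mA mB.
rewrite /phi_mu /= /pushforward.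
rewrite (_ : _ @^-1` _ = (mpext s @^-1` A) `*` (mpext s @^-1` B)) //.
rewrite product_measure1E.
- by rewrite -(mpext_pres s mA) -(mpext_pres s mB).
- by rewrite -[X in measurable X]setTI; exact: mpext_meas.
- by rewrite -[X in measurable X]setTI; exact: mpext_meas.
Qed.

Let preim_image (s : mpbij) (S : set R) : S `<=` I01 ->
  mpext s @^-1` (s @` S) = S.
Proof.
move=> SI; have [_ sinj _] := mp_bij s; apply/seteqP; split=> x /=.
- rewrite /mpext; case: ifPn => [/set_mem Ix [y Sy syx]|nIx [y Sy syx]].
    by rewrite -(sinj _ _ _ _ syx)// inE//; exact: SI.
  by move: nIx; rewrite -syx mem_set//; apply: mp_itv; exact: SI.
- by move=> Sx; rewrite mpextE; [exists x|exact: SI].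
Qed.

Lemma cut_dist_gact (f g : graphon) (s : mpbij) :
  cut_dist (gact f s) (gact g s) <= cut_dist f g.
Proof.
apply: cut_dist_le => S A mS mA SI AI.
have sI (B : set R) : B `<=` I01 -> s @` B `<=` I01.
  by move=> BI _ [x /BI Ix <-]; exact: mp_itv.
apply: le_trans (cut_dist_ge f g (mp_image s mS SI) (mp_image s mA AI)
  (sI _ SI) (sI _ AI)).
pose F : R * R -> R := (fun z => f z - g z) \_ (I01 `*` I01).
have FE x y : I01 x -> I01 y -> F (x, y) = f (x, y) - g (x, y).
  by move=> Ix Iy; rewrite /F patchE mem_set.
have mF : measurable_fun [set: R * R] (EFin \o F).
  apply/measurable_EFinP/(measurable_restrictT _ measurable_sq).
  exact: diff_meas.
have preS : phi s @^-1` ((s @` S) `*` (s @` A)) = S `*` A.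
  by rewrite -[in RHS](preim_image s SI) -[in RHS](preim_image s AI).
have mD : measurable ((s @` S) `*` (s @` A)).
  by apply: measurableX; exact: mp_image.
rewrite le_eqVlt; apply/orP; left; apply/eqP; congr `| _ |; symmetry.
transitivity (\int[(mu \x mu)%E]_(z in (s @` S) `*` (s @` A)) F z).
  apply: eq_Rintegral => -[x y] /set_mem[/= sx sy].
  by rewrite FE//; [exact: (sI _ SI _ sx)|exact: (sI _ AI _ sy)].
have FphiE x y : S x -> A y ->
    F (phi s (x, y)) = gact f s (x, y) - gact g s (x, y).
  move=> /SI Ix /AI Iy.
  by rewrite /phi /= !mpextE// FE//; exact: mp_itv.
rewrite /Rintegral; congr fine.
rewrite (@eq_measure_integral _ _ _ _ (phi_mu s)); last first.
  by move=> X mX _; exact: phi_pres.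
rewrite (integral_pushforward (phi_meas s) mF _ mD).
  rewrite preS; apply: eq_integral => -[x y] /set_mem[/= Sx Ay].
  by congr EFin; exact: FphiE.
rewrite preS.
have mSA : measurable (S `*` A : set RR) by exact: measurableX.
apply: (eq_integrable mSA (EFin \o (fun z => gact f s z - gact g s z))).
- by move=> [x y] /set_mem[/= Sx Ay]; congr EFin; rewrite -FphiE.
- exact: diff_int.
Qed.

Definition mpbij_id : mpbij.
Proof.
apply: (@MPBij id) => //.
- by split=> // x Ix; exists x.
- by move=> A mA _; rewrite image_id.
- by move=> A mA AI; rewrite preimage_id; congr (mu _); apply: setIidr.
Defined.

Definition mpbij_comp (s t : mpbij) : mpbij.
Proof.
apply: (@MPBij (s \o t)).
- exact: set_bij_comp (mp_bij t) (mp_bij s).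
- apply: (@measurable_comp _ _ _ _ _ _ I01).
  + exact: measurable_I01.
  + by move=> _ [x Ix <-]; exact: mp_itv.
  + exact: mp_meas.
  + exact: mp_meas.
- move=> A mA AI; rewrite -image_comp; apply: mp_image.
    exact: mp_image.
  by move=> _ [x /AI Ix <-]; exact: mp_itv.
- move=> A mA AI.
  rewrite -(mp_pres s mA AI) -(@mp_pres t (I01 `&` s @^-1` A)).
  + congr (mu _); apply/seteqP; split=> x /= [Ix].
      by move=> Ax; split=> //; split=> //; exact: mp_itv.
    by case.
  + exact: (mp_meas s measurable_I01 mA).
  + by move=> x [].
Defined.

Lemma orbit_closure_refl (g : graphon) : orbit_closure g g.
Proof.
move=> e e0; exists mpbij_id; apply: le_lt_trans e0.
apply: cut_dist_le => S A mS mA SI AI.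
rewrite (@eq_Rintegral _ _ _ _ _ (cst 0)); last by move=> [x y] _ /=; rewrite subrr.
by rewrite Rintegral_cst ?mul0r ?normr0//; exact: measurableX.
Qed.

Lemma delta_box_cls (f g : graphon) :
  delta_box (cls f) (cls g) =
  inf [set cut_dist f (gact g s) | s in [set: mpbij]].
Proof.
pose D (f g : graphon) :=
  inf [set cut_dist f (gact g s) | s in [set: mpbij]].
have has_infD f1 g1 :
    has_inf [set cut_dist f1 (gact g1 s) | s in [set: mpbij]].
  split; first by exists (cut_dist f1 (gact g1 mpbij_id)); exists mpbij_id.
  by exists 0 => _ [s _ <-]; exact: cut_dist_ge0.
suff leD f1 f2 g1 g2 : orbit_closure f1 = orbit_closure f2 ->
    orbit_closure g1 = orbit_closure g2 -> D f1 g1 <= D f2 g2.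
  have rE h : orbit_closure (rep (cls h)) = orbit_closure h.
    by have /(congr1 sval) := repK (cls h).
  by apply/eqP; rewrite eq_le; apply/andP; split; apply: leD.
move=> fE gE; apply/ler_addgt0Pr => e e0.
have e3 : 0 < e / 3 by rewrite divr_gt0.
have [_ [s _ <-] dlt] := inf_adherent e3 (has_infD f2 g2).
have [t ft] : exists t, cut_dist f1 (gact f2 t) < e / 3.
  by have := orbit_closure_refl f1; rewrite fE; exact.
have [r gr] : exists r, cut_dist g2 (gact g1 r) < e / 3.
  by have := orbit_closure_refl g2; rewrite -gE; exact.
pose u := mpbij_comp r (mpbij_comp s t).
have : D f1 g1 <= cut_dist f1 (gact g1 u).
  by apply: ge_inf; [have [] := has_infD f1 g1|exists u].
have := cut_dist_triangle (gact f2 t) f1 (gact g1 u).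
have := cut_dist_triangle (gact (gact g2 s) t) (gact f2 t) (gact g1 u).
have := cut_dist_gact f2 (gact g2 s) t.
have : cut_dist (gact (gact g2 s) t) (gact g1 u) <= cut_dist g2 (gact g1 r).
  apply: le_trans (cut_dist_gact g2 (gact g1 r) s).
  exact: (cut_dist_gact (gact g2 s) (gact (gact g1 r) s) t).
rewrite -/(D f2 g2) in dlt *.
lra.
Qed.

End delta_box_well_defined.

Section turan.

Definition turan_fun (k : R) (z : R * R) : R :=
  if Num.floor ((k - 1) * z.1) != Num.floor ((k - 1) * z.2) then 1 else 0.

Lemma turan_meas (k : R) : measurable_fun (I01 `*` I01) (turan_fun k).
Proof.
apply: measurable_funTS; rewrite /turan_fun.
under eq_fun do rewrite if_neg.
apply: measurable_fun_ifT => //.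
have mfl : measurable_fun [set: R] (fun x : R => (Num.floor x)%:~R : R).
  apply: measurable_realfun.nondecreasing_measurable => //.
  by move=> x y xy; rewrite ler_int; exact: le_floor.
have m1 : measurable_fun [set: R * R]
    (fun z : R * R => (Num.floor ((k - 1) * z.1))%:~R : R).
  apply: (measurableT_comp mfl); exact: measurable_funM.
have m2 : measurable_fun [set: R * R]
    (fun z : R * R => (Num.floor ((k - 1) * z.2))%:~R : R).
  apply: (measurableT_comp mfl); exact: measurable_funM.
apply: eq_measurable_fun (measurable_fun_eqr m1 m2).
by move=> z _ /=; rewrite eqr_int.
Qed.

Lemma turan_sym (k x y : R) : I01 x -> I01 y ->
  turan_fun k (x, y) = turan_fun k (y, x).
Proof. by rewrite /turan_fun eq_sym. Qed.

Lemma turan_itv (k x y : R) : I01 x -> I01 y -> 0 <= turan_fun k (x, y) <= 1.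
Proof. by rewrite /turan_fun; case: ifP; rewrite ?lexx ?ler01. Qed.

Definition turan (k : R) : graphon :=
  Graphon (turan_meas k) (@turan_sym k) (@turan_itv k).

End turan.

Section scale.
Variables (p : R) (p01 : 0 <= p <= 1) (g : graphon).

Let pg (z : R * R) : R := p * g z.

Let pg_meas : measurable_fun (I01 `*` I01) pg.
Proof. by apply: measurable_funM => //; exact: graphon_meas. Qed.

Let pg_sym x y : I01 x -> I01 y -> pg (x, y) = pg (y, x).
Proof. by move=> Ix Iy; rewrite /pg graphon_sym. Qed.

Let pg_itv x y : I01 x -> I01 y -> 0 <= pg (x, y) <= 1.
Proof.
move=> Ix Iy; have /andP[g0 g1] := graphon_itv g Ix Iy.
have /andP[p0 p1] := p01.
by rewrite /pg mulr_ge0//= mulr_ile1.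
Qed.

Definition gscale : graphon := Graphon pg_meas pg_sym pg_itv.

End scale.

(* The integral of [F] over the cube [0,1]^m with respect to dx_1 ... dx_m,
   as an iterated integral. *)
Fixpoint cube_int (m : nat) : (m.-tuple R -> R) -> R :=
  match m with
  | 0 => fun F => F [tuple]
  | m'.+1 => fun F =>
      \int[mu]_(x in I01) cube_int (fun t => F [tuple of x :: t])
  end.

(* Each edge {i, j} is counted once, as the pair with i < j. *)
Definition hom_density (m : nat) (H : sgraph m) (h : graphon) : R :=
  cube_int (fun x : m.-tuple R =>
    \prod_(e : 'I_m * 'I_m | (e.1 < e.2)%N && H e.1 e.2)
      h (tnth x e.1, tnth x e.2)).

Definition Tfun (m : nat) (H : sgraph m) (beta1 beta2 : R) (h : graphon) : R :=
  beta1 * (\int[(mu \x mu)%E]_(z in I01 `*` I01) h z)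
  + beta2 * hom_density H h.

(* [ln 0 = 0], so that 0 log 0 = 0 here. *)
Definition Ient (u : R) : R :=
  2^-1 * u * ln u + 2^-1 * (1 - u) * ln (1 - u).

Definition Ifun (h : graphon) : R :=
  \int[(mu \x mu)%E]_(z in I01 `*` I01) Ient (h z).

(* The set of points of [Wtilde] at which T - I is maximal: T and I are
   constant on classes, so these are the classes of the maximizers. *)
Definition Fstar (m : nat) (H : sgraph m) (beta1 beta2 : R) : set Wtilde :=
  [set cls f | f in [set f | forall h : graphon,
    Tfun H beta1 beta2 h - Ifun h <= Tfun H beta1 beta2 f - Ifun f]].

Definition psi (m : nat) (H : sgraph m) (beta1 beta2 : R) : R :=
  sup [set Tfun H beta1 beta2 h - Ifun h | h in [set: graphon]].

Definition edge_prob (beta1 : R) : R :=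
  expR (2 * beta1) / (1 + expR (2 * beta1)).

Lemma edge_prob_itv (beta1 : R) : 0 <= edge_prob beta1 <= 1.
Proof.
have e0 := expR_gt0 (2 * beta1).
have d0 : 0 < 1 + expR (2 * beta1) by rewrite addr_gt0.
apply/andP; split; first by rewrite divr_ge0// ltW.
by rewrite ler_pdivrMr// mul1r lerDr.
Qed.

End graphons.

(* Main.v *)
Require Import Defs.
From mathcomp Require Import all_boot all_order all_algebra.
From mathcomp Require Import fingroup perm.
From mathcomp Require Import ring lra zify.

Set Implicit Arguments.
Unset Strict Implicit.
Unset Printing Implicit Defensive.

Import Order.TTheory GRing.Theory Num.Theory.

(** Write p for the edge probability, r = chi(H) - 1, and let the energy of a
    graphon f be the integral of beta1 f - I(f), so that T - I is the energy
    plus beta2 t(H,f).  By relative entropy, u |-> beta1 u - I(u) is at most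
    ell = log (1/(1-p)) / 2 on [0,1], with equality at u = p only and a
    quadratic gap ([tilt_le]), and it is close to 0 for small u
    ([tilt_le_sqrt]).  Hence the energy of f is at most about ell times the
    area of U = {f >= eta}, and if it is close to that bound then f is L^1-close
    to p times the indicator of U ([energy_deviation]).

    The function p times the complete balanced r-partite graphon contains no
    copy of H and has energy ell (1 - 1/r) >= 0, which is the announced limit
    of psi.  A graphon that does at least as well for a very negative beta2 must
    therefore have few copies of H.  What remains is a stability form of the
    Erdos-Stone theorem: few copies of H force U to have area at most about
    1 - 1/r, and near equality forces U to be close to the complete balanced
    r-partite graph after a rearrangement of [0,1].

    This is proved without compactness of the space of graphons.  Measurable
    subsets of the square are approximated in measure by unions of cells of
    every fine enough grid ([measurable_grid_approx]), and homomorphism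
    densities are Lipschitz for the L^1 distance, so that U becomes a finite
    graph G on the cells ([clique_density_le_hom]).  Duplicating vertices shows
    that few copies of H imply few cliques on r + 1 vertices
    ([sum_swappable], [tuple_avg_survivors]).  Then a variant of Furedi's proof
    of stability that tolerates a few cliques ([few_cliques_partition]) colours
    the cells with r colours, with few edges inside the colour classes and
    classes of nearly equal sizes.  A permutation of the cells moves these
    classes to the r intervals of the Turan function up to a few cells
    ([perm_match], [near_extremal]), and a permutation of cells is a
    measure-preserving bijection of [0,1] ([perm_mpbij]).  The outcome is
    [few_homs_structure], from which both limits follow. *)

(** * Graphs with few cliques are nearly multipartite *)

Section graph_counts.
Variables (V : finType) (E : rel V).
Hypothesis Esym : symmetric E.

Definition neighbours (x : V) : {set V} := [set y | E x y].

(** Counts ordered pairs; loops are allowed throughout, since the grid graphs below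
    may have them. *)
Definition edges (A B : {set V}) : nat := \sum_(x in A) #|B :&: neighbours x|.

(** Ordered cliques, each counted once per ordering; the recursion on common
    neighbourhoods is the one that the partition argument follows. *)
Fixpoint cliques (k : nat) (A : {set V}) : nat :=
  if k is k'.+1 then \sum_(x in A) cliques k' (A :&: neighbours x) else 1.

Lemma edgesC A B : edges A B = edges B A.
Proof.
rewrite /edges.
transitivity (\sum_(x in A) \sum_(y in B | E x y) 1).
  by apply: eq_bigr => x _; rewrite -sum1_card; apply: eq_bigl => y; rewrite !inE.
rewrite (exchange_big_dep (mem B)) /=; last by move=> x y _ /andP[].
apply: eq_bigr => y yB; rewrite -sum1_card; apply: eq_bigl => x.
by rewrite !inE Esym yB.
Qed.

Lemma edgesUl (A B C : {set V}) : [disjoint A & B] -> edges (A :|: B) C = edges A C +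
  edges B C.
Proof. by move=> dAB; rewrite /edges -bigU//=; apply: eq_bigl => x; rewrite !inE. Qed.

Lemma edgesUr (A B C : {set V}) : [disjoint A & B] -> edges C (A :|: B) = edges C A +
  edges C B.
Proof. by move=> dAB; rewrite !(edgesC C) edgesUl. Qed.

Lemma edges_le A B : edges A B <= #|A| * #|B|.
Proof.
rewrite /edges -sum_nat_const; apply: leq_sum => x _.
by apply: subset_leq_card; apply: subsetIl.
Qed.

(** Supplies many vertices of nearly maximal degree: a single vertex of maximal
    degree might lie in too many cliques, while among g candidates one must lie in
    few. *)
Lemma top_values (f : V -> nat) (A : {set V}) g : g <= #|A| ->
  exists X : {set V}, [/\ X \subset A, #|X| = g &
    forall x y, x \in X -> y \in A :\: X -> f y <= f x].
Proof.
elim: g => [|g IH] gA.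
  by exists set0; split; rewrite ?sub0set ?cards0// => x y; rewrite inE.
have [X [XA cX Xtop]] := IH (ltnW gA).
have [z0 z0P] : exists z0, z0 \in A :\: X.
  by apply/set0Pn; rewrite -card_gt0 cardsDS// cX subn_gt0.
case: (@arg_maxnP V z0 (mem (A :\: X)) f z0P) => z zP zmax.
have /setDP[zA zX] : z \in A :\: X by [].
exists (z |: X); split.
- by rewrite subUset sub1set zA.
- by rewrite cardsU1 zX cX.
move=> x y /setU1P[->|xX] /setDP[yA]; rewrite in_setU1 negb_or => /andP[yz yX].
  by apply: zmax; rewrite !inE yX yA.
by apply: Xtop => //; rewrite inE yA yX.
Qed.

(** The induction of Furedi's proof of the stability theorem.  A vertex x of maximal
    degree in A splits A into the non-neighbours A1 of x, which become a colour
    class, and the neighbours A2.  Every vertex of A1 has degree at most |A2|, and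
    summing these degrees counts the edges inside A1 twice and the edges between A1
    and A2 once.  Instead of an exact maximum, x is taken among the g vertices of
    highest degree; this costs an error g |V| at each step, and makes it possible to
    choose x in few cliques, so that A2 satisfies the induction hypothesis. *)
Theorem few_cliques_partition k g (A : {set V}) :
  cliques k.+2 A < g ^ k.+2 ->
  exists c : V -> 'I_k.+1,
    edges A A + \sum_i edges [set x in A | c x == i] [set x in A | c x == i]
    + \sum_i #|[set x in A | c x == i]| ^ 2
    <= #|A| ^ 2 + 2 * k.+1 * g * #|V|.
Proof.
(* A set with at most g |V| edges can be given a single colour. *)
have const_colouring k' (B : {set V}) : edges B B <= g * #|V| ->
  exists c : V -> 'I_k'.+1,
    edges B B + \sum_i edges [set x in B | c x == i] [set x in B | c x == i]
    + \sum_i #|[set x in B | c x == i]| ^ 2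
    <= #|B| ^ 2 + 2 * k'.+1 * g * #|V|.
  move=> eB; exists (fun=> ord0); rewrite !big_ord_recl !big1.
  - rewrite (_ : [set x in B | _] = B); first by nia.
    by apply/setP => x; rewrite !inE eqxx andbT.
  - by move=> i _; rewrite (_ : [set x in B | _] = set0) ?cards0//; apply/setP => x;
    rewrite !inE andbF.
  - move=> i _; rewrite (_ : [set x in B | _] = set0) /edges ?big_set0//.
    by apply/setP => x; rewrite !inE andbF.
have AV (B : {set V}) : #|B| <= #|V| by exact: max_card.
elim: k A => [|k IH] A.
  move=> c2; apply: const_colouring.
  have e2 : edges A A < g ^ 2.
    apply: leq_ltn_trans c2; rewrite /edges /=; apply: leq_sum => x xA.
    by rewrite sum1_card.
  have [gV|Vg] := leqP g #|V|.
    by apply: leq_trans (ltnW e2) _; rewrite expnS expn1 leq_mul2l gV orbT.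
  apply: leq_trans (edges_le A A) _; apply: leq_mul (AV A).
  by apply: leq_trans (AV A) (ltnW Vg).
move=> cA; have [Ag|gA] := ltnP #|A| g.
  apply: const_colouring; apply: leq_trans (edges_le A A) _.
  by apply: leq_mul; rewrite ?AV// ltnW.
pose d x := #|A :&: neighbours x|.
have [X [XA cX Xtop]] := top_values d gA.
have [x xX cx] : exists2 x, x \in X & cliques k.+2 (A :&: neighbours x) < g ^ k.+2.
  apply/exists_inP; apply: contraTT cA; rewrite -leqNgt => /exists_inPn H.
  rewrite expnS -{1}cX -sum_nat_const.
  change (\sum_(i in X) g ^ k.+2 <= \sum_(x in A) cliques k.+2 (A :&: neighbours x)).
  rewrite [leqRHS](big_setID X) /= (setIidPr XA); apply: leq_trans (leq_addr _ _).
  by apply: leq_sum => i iX; rewrite leqNgt; exact: H.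
pose A1 := A :\: neighbours x; pose A2 := A :&: neighbours x.
have dA : [disjoint A1 & A2].
  by rewrite disjoint_sym -setI_eq0; apply/eqP/setP => y; rewrite !inE; case: (E x y);
    rewrite ?andbF.
have AE : A = A1 :|: A2 by rewrite setUC setID.
have [c' c'P] := IH _ cx.
pose c y := if y \in A2 then lift ord0 (c' y) else ord0.
exists c; rewrite big_ord_recl [\sum_(i < k.+2) #|_| ^ 2]big_ord_recl.
have -> : [set x0 in A | c x0 == ord0] = A1.
  apply/setP => y; rewrite !inE /c /A2 inE in_set.
  by case: (y \in A) => //=; case: (E x y).
have cE i : [set x0 in A | c x0 == lift ord0 i] = [set x0 in A2 | c' x0 == i].
  apply/setP => y; rewrite !inE /c /A2 inE in_set.
  case: (y \in A) => //=; case: (E x y) => //=.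
have -> : \sum_(i < k.+1) edges [set x0 in A | c x0 == lift ord0 i] [set x0 in A | c x0
  == lift ord0 i] =
    \sum_(i < k.+1) edges [set x0 in A2 | c' x0 == i] [set x0 in A2 | c' x0 == i].
  by apply: eq_bigr => i _; rewrite cE.
have -> : \sum_(i < k.+1) #|[set x0 in A | c x0 == lift ord0 i]| ^ 2 =
    \sum_(i < k.+1) #|[set x0 in A2 | c' x0 == i]| ^ 2.
  by apply: eq_bigr => i _; rewrite cE.
have eA : edges A A + edges A1 A1 = 2 * edges A1 A + edges A2 A2.
  rewrite {1 2 3}AE edgesUl// !edgesUr// (edgesC A2 A1); lia.
(* Only the at most g vertices of X can have degree above |A2|. *)
have eA1 : edges A1 A <= #|A1| * #|A2| + g * #|V|.
  rewrite /edges (big_setID X) /= addnC; apply: leq_add.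
    apply: leq_trans (_ : \sum_(i in A1 :\: X) #|A2| <= _).
      apply: leq_sum => y /setDP[/setDP[yA _] yX].
      by apply: (Xtop x y) => //; rewrite inE yX yA.
    by rewrite sum_nat_const leq_mul2r subset_leq_card ?orbT// subsetDl.
  apply: leq_trans (_ : \sum_(i in A1 :&: X) #|V| <= _).
    by apply: leq_sum => y _; exact: AV.
  by rewrite sum_nat_const leq_mul2r -cX subset_leq_card ?orbT// subsetIr.
have cAE : #|A| = #|A1| + #|A2| by rewrite {1}AE cardsU (disjoint_setI0 dA) cards0 subn0.
move: c'P eA eA1; rewrite cAE -/A2.
set s1 := \sum_i _; set s2 := \sum_i _.
set e1 := edges A A; set e2 := edges A1 A1; set e3 := edges A1 A; set e4 := edges A2 A2.
set a1 := #|A1|; set a2 := #|A2|; set v := #|V|.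
have -> : (a1 + a2) ^ 2 = a1 ^ 2 + a2 ^ 2 + 2 * (a1 * a2) by rewrite !expnS expn0; lia.
have -> : 2 * k.+2 * g * v = 2 * k.+1 * g * v + 2 * (g * v) by lia.
lia.
Qed.

End graph_counts.

(** * Few homomorphisms imply few cliques *)

Section clique_maps.
Variables (V : finType) (E : rel V).
Hypothesis Esym : symmetric E.

Definition clique_maps k (A : {set V}) : {set {ffun 'I_k -> V}} :=
  [set x : {ffun _ -> _} | [forall a, x a \in A] &&
           [forall a, [forall b, (a != b) ==> E (x a) (x b)]]].

Lemma cliques_le_card k (A : {set V}) : cliques E k A <= #|clique_maps k A|.
Proof.
elim: k A => [|k IH] A /=.
  apply/card_gt0P; have f : {ffun 'I_0 -> V} by apply: finfun => -[].
  by exists f; rewrite inE; apply/andP; split; apply/forallP => -[].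
rewrite -(card_imset (mem (clique_maps k.+1 A)) (@inj_id _)) imset_id.
pose pr (x : {ffun 'I_k.+1 -> V}) := x ord0.
rewrite -[leqRHS]sum1_card (partition_big pr (mem A)) /=; last first.
  by move=> x; rewrite inE => /andP[/forallP/(_ ord0)].
apply: leq_sum => y yA; apply: leq_trans (IH _) _.
rewrite sum1_card.
pose ext (x : {ffun 'I_k -> V}) : {ffun 'I_k.+1 -> V} :=
  [ffun i => if unlift ord0 i is Some j then x j else y].
have ext_inj : injective ext.
  move=> x x' /ffunP xx; apply/ffunP => i.
  by have := xx (lift ord0 i); rewrite !ffunE liftK.
rewrite -(card_imset _ ext_inj); apply: subset_leq_card.
apply/subsetP => _ /imsetP[x + ->]; rewrite inE => /andP[/forallP xA /forallP xE].
have xA' a : (x a \in A) && E y (x a) by have := xA a; rewrite !inE.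
rewrite unfold_in /= inE /pr ffunE unlift_none eqxx andbT.
apply/andP; split.
  apply/forallP => i; rewrite ffunE; case: unliftP => [j|] _ //.
  by case/andP: (xA' j).
apply/forallP => i; apply/forallP => j; apply/implyP; rewrite !ffunE.
case: unliftP => [i'|] ->; case: unliftP => [j'|] -> ij.
- have /forallP/(_ j')/implyP := xE i'; apply.
  by apply: contraNneq ij => ->.
- by rewrite Esym; case/andP: (xA' i').
- by case/andP: (xA' j').
- by rewrite eqxx in ij.
Qed.

End clique_maps.

(** The standard proof that a positive density of cliques gives a positive density of
    every blow-up, organised so that the vertices of the blow-up are chosen one after
    the other: a vertex y of colour c is compatible with a clique x if replacing the
    entry x c by y still gives a clique, and only the compatible cliques are kept. *)
Section blowup.
Variables (V : finType) (k : nat).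
Implicit Types (S : {set {ffun 'I_k -> V}}) (x : {ffun 'I_k -> V}).

Definition update x (c : 'I_k) (y : V) : {ffun 'I_k -> V} :=
  [ffun i => if i == c then y else x i].

Definition swappable S (c : 'I_k) (y : V) := [set x in S | update x c y \in S].

Local Open Scope ring_scope.

Lemma CauchySchwarz_sum (R : realFieldType) (T : finType) (P : pred T) (f : T -> R) :
  (\sum_(i | P i) f i) ^+ 2 <= #|P|%:R * \sum_(i | P i) f i ^+ 2.
Proof.
have [P0|P0] := posnP #|P|.
  rewrite P0 mul0r big_pred0 ?expr0n// => i; apply/negbTE/negP => Pi.
  by move: P0 => /card0_eq/(_ i); rewrite unfold_in Pi.
have n0 : 0 < #|P|%:R :> R by rewrite ltr0n.
set n : R := #|P|%:R in n0 *; set s := \sum_(i | P i) f i.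
have : 0 <= \sum_(i | P i) (f i - s / n) ^+ 2 by apply: sumr_ge0 => i _; exact: sqr_ge0.
under eq_bigr do rewrite sqrrB -mulrnAl -[f _ *+ 2]mulr_natl -!mulrA [f _ * _]mulrC !mulrA.
rewrite big_split sumrB /= -mulr_sumr -/s sumr_const -mulr_natl -/n.
set q := \sum_(i | P i) f i ^+ 2.
rewrite (_ : _ + _ = q - s ^+ 2 / n); last by field; rewrite gt_eqF.
by rewrite subr_ge0 ler_pdivrMr// mulrC.
Qed.

(** For fixed entries of x outside c, let d be the number of values at c that give an
    element of S.  The elements of S number the sum of d, the pairs counted on the
    right the sum of d^2, and Cauchy-Schwarz compares them.  Hence the average density
    of [swappable S c y] over y is at least the square of the density of S. *)
Lemma sum_swappable S (c : 'I_k) :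
  (#|S| ^ 2 * #|V| <= #|V| ^ k * \sum_y #|swappable S c y|)%N.
Proof.
have [V0|V0] := posnP #|V|; first by rewrite V0 muln0.
pose d x := #|[set y | update x c y \in S]|%N.
have card_ff : #|{ffun 'I_k -> V}| = (#|V| ^ k)%N by rewrite card_ffun card_ord.
(* The involution exchanging y with the entry of x at c turns sums over both
   arguments into sums over elements of S. *)
pose rot (z : {ffun 'I_k -> V} * V) := (update z.1 c z.2, z.1 c).
have rotK : involutive rot.
  move=> [x y]; rewrite /rot /= ffunE eqxx; congr (_, _).
  by apply/ffunP => i; rewrite !ffunE; case: eqP => // ->.
have update_update x y y' : update (update x c y) c y' = update x c y'.
  by apply/ffunP => i; rewrite !ffunE; case: eqP.
have dE x y : d (update x c y) = d x.
  by apply: eq_card => y'; rewrite !inE update_update.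
have sum_d : (\sum_x d x = #|V| * #|S|)%N.
  transitivity (\sum_(z : {ffun 'I_k -> V} * V) (update z.1 c z.2 \in S))%N.
    rewrite -(pair_bigA _ (fun x y => (update x c y \in S) : nat)) /=.
    by apply: eq_bigr => x _; rewrite /d -sum1dep_card big_mkcond.
  rewrite (reindex_inj (inv_inj rotK)) /=.
  transitivity (\sum_(z : {ffun 'I_k -> V} * V) (z.1 \in S))%N.
    apply: eq_bigr => -[x y] _ /=; congr (nat_of_bool (_ \in S)).
    by apply/ffunP => i; rewrite !ffunE; case: eqP => // ->.
  rewrite -(pair_bigA _ (fun x (y : V) => (x \in S) : nat)) /=.
  under eq_bigr do rewrite sum_nat_const.
  by rewrite -big_distrr /= -big_mkcond sum1_card.
have sum_d2 : (\sum_x d x ^ 2 = #|V| * \sum_y #|swappable S c y|)%N.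
  transitivity (\sum_x \sum_y (update x c y \in S) * d x)%N.
    apply: eq_bigr => x _; rewrite -big_distrl /= expnS expn1; congr (_ * _)%N.
    by rewrite /d -sum1dep_card big_mkcond.
  transitivity (\sum_(z : {ffun 'I_k -> V} * V) (update z.1 c z.2 \in S) * d z.1)%N.
    by rewrite -(pair_bigA _ (fun x y => (update x c y \in S) * d x)%N).
  rewrite (reindex_inj (inv_inj rotK)) /=.
  transitivity (\sum_(z : {ffun 'I_k -> V} * V) (z.1 \in S) * d z.1)%N.
    apply: eq_bigr => -[x y] _ /=; rewrite dE; congr ((_ \in S) * _)%N.
    by apply/ffunP => i; rewrite !ffunE; case: eqP => // ->.
  rewrite -(pair_bigA _ (fun x (y : V) => (x \in S) * d x)%N) /=.
  under eq_bigr do rewrite sum_nat_const.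
  rewrite -big_distrr /=; congr (_ * _)%N.
  transitivity (\sum_x \sum_y ((x \in S) * (update x c y \in S)))%N.
    apply: eq_bigr => x _; rewrite -big_distrr /= /d; congr (_ * _)%N.
    by rewrite -sum1dep_card big_mkcond.
  rewrite exchange_big /=; apply: eq_bigr => y _.
  rewrite -sum1dep_card [RHS]big_mkcond /=; apply: eq_bigr => x _.
  by rewrite mulnb; case: (_ && _).
have := @CauchySchwarz_sum rat _ predT (fun x => (d x)%:R).
rewrite -natr_sum sum_d cardT -cardE card_ff.
rewrite (_ : \sum_x (d x)%:R ^+ 2 = (\sum_x d x ^ 2)%N%:R); last by rewrite natr_sum;
  under [RHS]eq_bigr do rewrite natrX.
rewrite sum_d2 -natrX -natrM ler_nat => CS.
rewrite -(leq_pmul2l V0) mulnA [(#|V| * (_ * _))%N]mulnCA.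
by rewrite (_ : _ * _ * _ = (#|V| * #|S|) ^ 2)%N // expnMn mulnAC -[(#|V| ^ 2)%N]mulnn.
Qed.

Variable R : realFieldType.

(** The discrete counterpart of [cube_int]: sharing its recursion makes their
    comparison on step functions ([cube_int_cell]) a direct induction. *)
Fixpoint tuple_avg m : (m.-tuple V -> R) -> R :=
  match m with
  | 0 => fun F => F [tuple]
  | m'.+1 => fun F => #|V|%:R^-1 * \sum_y tuple_avg (fun t => F [tuple of y :: t])
  end.

Fixpoint survivors S (cs : seq 'I_k) (t : seq V) : {set {ffun 'I_k -> V}} :=
  match cs, t with
  | c :: cs', y :: t' => survivors (swappable S c y) cs' t'
  | _, _ => S
  end.

Definition map_density S : R := #|S|%:R / (#|V| ^ k)%N%:R.

(** Jensen's inequality for the powers x^(2^n), by iterating Cauchy-Schwarz. *)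
Lemma tuple_avg_power (f : V -> R) n : (0 < #|V|)%N -> (forall y, 0 <= f y) ->
  (#|V|%:R^-1 * \sum_y f y) ^+ (2 ^ n) <= #|V|%:R^-1 * \sum_y f y ^+ (2 ^ n).
Proof.
move=> V0; have v0 : 0 < #|V|%:R :> R by rewrite ltr0n.
elim: n f => [|n IH] f f0; first by rewrite expn0 expr1;
  under [in leRHS]eq_bigr do rewrite expr1.
rewrite expnS exprM; under [in leRHS]eq_bigr do rewrite exprM.
apply: le_trans (IH (fun y => f y ^+ 2) _); last by move=> y; exact: sqr_ge0.
apply: lerXn2r; rewrite ?nnegrE ?sqr_ge0//.
  by rewrite mulr_ge0 ?invr_ge0 ?ler0n// sumr_ge0// => y _; exact: sqr_ge0.
have := @CauchySchwarz_sum R V predT f; rewrite cardT -cardE => CS.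
rewrite exprMn exprVn -ler_pdivlMl ?invr_gt0 ?exprn_gt0// invrK mulrA.
by rewrite expr2 mulfK ?gt_eqF.
Qed.

(** Each choice of a vertex squares the density on average, so by convexity a
    fraction of at least (density of S)^(2^m) of the tuples leaves a survivor. *)
Lemma tuple_avg_survivors S (V0 : (0 < #|V|)%N) m (cs : m.-tuple 'I_k) (F : m.-tuple V
  -> R) :
  (forall t, 0 <= F t) ->
  (forall t : m.-tuple V, survivors S cs t != set0 -> 1 <= F t) ->
  map_density S ^+ (2 ^ m) <= tuple_avg F.
Proof.
have v0 : 0 < #|V|%:R :> R by rewrite ltr0n.
have vk0 : 0 < (#|V| ^ k)%N%:R :> R by rewrite ltr0n expn_gt0 V0.
have dens0 S' : 0 <= map_density S' by rewrite divr_ge0 ?ler0n.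
elim: m S cs F => [|m IH] S cs F F0 F1.
  rewrite expn0 expr1 /=; have [S0|S0] := eqVneq S set0.
    by rewrite /map_density S0 cards0 mul0r.
  apply: le_trans (_ : 1 <= _); last by apply: F1; rewrite tuple0.
  rewrite ler_pdivrMr// mul1r ler_nat.
  by apply: leq_trans (max_card _) _; rewrite card_ffun card_ord.
case/tupleP: cs F1 => c cs F1 /=.
have step y : map_density (swappable S c y) ^+ (2 ^ m) <= tuple_avg (fun t => F [tuple
  of y :: t]).
  by apply: (IH _ cs) => // t tS; apply: F1.
apply: le_trans (_ : #|V|%:R^-1 * \sum_y map_density (swappable S c y) ^+ (2 ^ m) <= _);
  last first.
  by rewrite ler_pM2l ?invr_gt0//; apply: ler_sum => y _.
apply: le_trans (tuple_avg_power _ V0 (fun y => dens0 _)).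
rewrite expnS exprM; apply: lerXn2r; rewrite ?nnegrE ?sqr_ge0//.
  by rewrite mulr_ge0 ?invr_ge0 ?ler0n// sumr_ge0.
rewrite /map_density -mulr_suml -natr_sum expr_div_n.
have := sum_swappable S c; rewrite -(ler_nat R) natrM natrX natrM.
set a := #|S|%:R; set b := (\sum_y _)%N%:R.
move: v0 vk0; set v := #|V|%:R; set w := (_ ^ k)%N%:R => v0 w0 h.
rewrite ler_pdivrMr ?exprn_gt0// (_ : v^-1 * (b / w) * w ^+ 2 = w * b / v);
  last by field; rewrite !gt_eqF.
by rewrite ler_pdivlMr.
Qed.

Lemma survivors_sub S cs t : survivors S cs t \subset S.
Proof.
elim: cs S t => [|c cs IH] S [|y t] //=.
by apply: subset_trans (IH _ _) _; apply/subsetP => x; rewrite inE => /andP[].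
Qed.

Lemma survivors_update S cs t x j c0 y0 : size cs = size t -> (j < size cs)%N ->
  x \in survivors S cs t -> update x (nth c0 cs j) (nth y0 t j) \in S.
Proof.
elim: cs S t j => [|c cs IH] S [|y t] [|j] //= [sz] jlt xS.
  by have /subsetP/(_ _ xS) := survivors_sub (swappable S c y) cs t; rewrite inE => /andP[].
by have := IH _ _ _ sz jlt xS; rewrite inE => /andP[].
Qed.

Lemma survivors_update2 S cs t x i j c0 y0 : size cs = size t -> (i < j < size cs)%N ->
  x \in survivors S cs t ->
  update (update x (nth c0 cs j) (nth y0 t j)) (nth c0 cs i) (nth y0 t i) \in S.
Proof.
elim: cs S t i j => [|c cs IH] S [|y t] i j //=; first by rewrite ltn0 andbF.
case: i j => [|i] [|j] //= [sz] ijlt xS.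
  by have := survivors_update c0 y0 sz ijlt xS; rewrite inE => /andP[].
by have := IH _ _ _ _ sz ijlt xS; rewrite inE => /andP[].
Qed.

(** If a clique x survives, then substituting both t_j and t_i for the entries of x of
    their colours still gives a clique, so t_i and t_j are adjacent.  A tuple with a
    survivor is thus a homomorphism of every graph properly coloured by cs. *)
Lemma survivors_adjacent (E : rel V) m (cs : m.-tuple 'I_k) (t : m.-tuple V) (i j : 'I_m) :
  survivors (clique_maps E k setT) cs t != set0 -> (i < j)%N ->
  tnth cs i != tnth cs j -> E (tnth t i) (tnth t j).
Proof.
move=> /set0Pn[x xS] ij cij.
have := @survivors_update2 _ _ _ _ i j (tnth cs i) (tnth t i) _ _ xS.
rewrite !size_tuple ij ltn_ord -!tnth_nth => /(_ erefl isT).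
rewrite inE => /andP[_ /forallP/(_ (tnth cs i))/forallP/(_ (tnth cs j))].
by rewrite cij /= !ffunE !eqxx (negbTE (contraNneq _ cij)) // => ->.
Qed.

End blowup.

(** * From a nearly extremal graph to the Turan graph *)

Section match_colouring.
Variables (V C : finType) (c d : V -> C).

(** Take s with the largest number of agreements.  If for some colour i there were
    both a with c a = i placed outside of the block i, and b placed in the block i
    with c b <> i, exchanging their images would gain an agreement.  Therefore the
    disagreements of colour i are exactly the excess of that colour, if there is one. *)
Lemma perm_match : exists s : {perm V},
  #|[set a | d (s a) != c a]| <= \sum_i (#|[set a | c a == i]| - #|[set a | d a == i]|).
Proof.
pose agree (s : {perm V}) := #|[set a | d (s a) == c a]|.
case: (@arg_maxnP {perm V} 1%g predT agree isT) => s _ smax.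
exists s; rewrite -sum1dep_card (partition_big c predT) //=.
apply: leq_sum => i _; rewrite sum1dep_card.
have cds : #|[set a | d a == i]| = #|[set a | d (s a) == i]|.
  rewrite -[RHS](card_imset _ (@perm_inj _ s)); apply: eq_card => b.
  apply/idP/imsetP.
    rewrite inE => bi; exists ((s^-1)%g b); last by rewrite permKV.
    by rewrite inE permKV.
  by move=> [a]; rewrite !inE => ai ->.
have [->|/set0Pn[a]] := eqVneq [set a | (d (s a) != c a) && (c a == i)] set0.
  by rewrite cards0.
rewrite inE => /andP[da /eqP ca].
have sub : [set b | d (s b) == i] \subset [set b | c b == i].
  apply/subsetP => b; rewrite !inE => /eqP db;
    apply: contraTT (smax (tperm a b * s)%g isT) => cb.
  rewrite -ltnNge; apply: proper_card; apply/properP; split.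
    apply/subsetP => z; rewrite !inE permM.
    case: tpermP => [-> | -> | //]; first by rewrite (negbTE da).
    by rewrite db eq_sym (negbTE cb).
  exists a; rewrite !inE ?(negbTE da)// permM tpermL db ca//.
rewrite cds -cardsDS//; apply: subset_leq_card.
by apply/subsetP => b; rewrite !inE => /andP[db /eqP <-]; rewrite db eqxx.
Qed.

End match_colouring.

Local Open Scope ring_scope.

(** From here on G is a graph on n + 1 = r M cells with r = k + 1, the target
    partition is that into r blocks of M consecutive cells, and the counts are divided
    by the square of the number of cells. *)
Section stability.
Variables (R : archiRealFieldType) (n k M : nat).
Hypothesis nE : n.+1 = (k.+1 * M)%N.
Variable G : rel 'I_n.+1.
Hypothesis Gsym : symmetric G.

Local Notation N := (n.+1%:R : R).
Local Notation r := (k.+1%:R : R).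

Definition block (a : 'I_n.+1) : 'I_k.+1 := inord (a %/ M).

Let M0 : (0 < M)%N. Proof. by move: nE; case: M => //; rewrite muln0. Qed.

Lemma blockE a : block a = (a %/ M)%N :> nat.
Proof. by rewrite /block inordK// ltn_divLR// -nE. Qed.

Lemma card_block i : (M <= #|[set a | block a == i]|)%N.
Proof.
have lt (j : 'I_M) : (i * M + j < n.+1)%N.
  rewrite nE; apply: leq_trans (_ : i.+1 * M <= _)%N;
    last by rewrite leq_mul2r ltn_ord orbT.
  by rewrite mulSn addnC ltn_add2r.
pose h (j : 'I_M) : 'I_n.+1 := inord (i * M + j).
have hE j : h j = (i * M + j)%N :> nat by rewrite /h inordK.
have h_inj : injective h.
  by move=> j j' /(congr1 val) /=; rewrite !hE => /addnI /val_inj.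
rewrite -{1}[M]card_ord -(card_imset _ h_inj); apply: subset_leq_card.
apply/subsetP => _ /imsetP[j _ ->]; rewrite inE -val_eqE /= blockE hE.
by rewrite divnMDl// divn_small// addn0.
Qed.

Definition pair_count (e : rel 'I_n.+1) : R := \sum_a \sum_b (e a b)%:R.

Lemma pair_count_ge0 e : 0 <= pair_count e.
Proof. by apply: sumr_ge0 => a _; apply: sumr_ge0 => b _; exact: ler0n. Qed.

Lemma pair_count_nat (e : rel 'I_n.+1) : (\sum_a \sum_b (e a b : nat))%N%:R = pair_count e.
Proof. by rewrite natr_sum; apply: eq_bigr => a _; rewrite natr_sum. Qed.

Section colouring.
Variable c : 'I_n.+1 -> 'I_k.+1.
Let V i : {set 'I_n.+1} := [set a | c a == i].

Lemma edges_setT : edges G setT setT = (\sum_a \sum_b (G a b : nat))%N.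
Proof.
rewrite /edges; apply: eq_big => a; first by rewrite inE.
move=> _; rewrite -sum1_card big_mkcond /=; apply: eq_bigr => b _.
by rewrite !inE; case: (G a b).
Qed.

Lemma sum_edges_colour :
  (\sum_i edges G (V i) (V i) = \sum_a \sum_b (G a b && (c a == c b) : nat))%N.
Proof.
rewrite [RHS](partition_big c predT)//=; apply: eq_bigr => i _.
rewrite /edges; apply: eq_big => a; first by rewrite inE.
rewrite inE => /eqP <-; rewrite -sum1_card big_mkcond /=; apply: eq_bigr => b _.
by rewrite !inE andbC [c b == _]eq_sym; case: (_ && _).
Qed.

Lemma sum_card_colour : (\sum_i #|V i| ^ 2 = \sum_a \sum_b (c a == c b : nat))%N.
Proof.
rewrite [RHS](partition_big c predT)//=; apply: eq_bigr => i _.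
rewrite expnS expn1 -[in X in (X * _)%N]sum1_card big_distrl /=.
apply: eq_big => a; first by rewrite inE.
rewrite inE => /eqP <-; rewrite mul1n -sum1_card big_mkcond /=; apply: eq_bigr => b _.
by rewrite !inE [c b == _]eq_sym; case: (_ == _).
Qed.

Lemma sum_colour_sizes : \sum_i #|V i|%:R = N.
Proof.
rewrite -natr_sum; congr _%:R; rewrite -[RHS]card_ord -sum1_card (partition_big c predT)//=.
by apply: eq_bigr => i _; rewrite -sum1_card; apply: eq_bigl => a; rewrite inE.
Qed.

(** Nearly maximal edge counts make the left-hand side small, hence the classes
    balanced. *)
Lemma sum_sqr_dev : \sum_i (#|V i|%:R - M%:R) ^+ 2 = pair_count (fun a b => c a == c b)
  - N ^+ 2 / r.
Proof.
under eq_bigr do rewrite sqrrB.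
rewrite big_split sumrB /= sumr_const card_ord.
rewrite -pair_count_nat -sum_card_colour natr_sum.
have -> : \sum_i (#|V i|%:R * M%:R *+ 2 : R) = 2 * M%:R * \sum_i #|V i|%:R.
  by rewrite mulr_sumr; apply: eq_bigr => i _; rewrite -mulr_natl [_ * M%:R]mulrC mulrA.
under [in RHS]eq_bigr do rewrite natrX.
rewrite -addrA; congr (_ + _); rewrite -mulr_natl.
rewrite sum_colour_sizes nE natrM; field.
by rewrite nat1r pnatr_eq0.
Qed.

Lemma disagree_pair_count :
  pair_count (fun a b => G a b != (c a != c b)) =
  N ^+ 2 - pair_count G - pair_count (fun a b => c a == c b) + 2 * pair_count (fun a b
    => G a b && (c a == c b)).
Proof.
have -> : N ^+ 2 = pair_count (fun _ _ => true).
  transitivity (\sum_(a < n.+1) N);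
    first by rewrite sumr_const card_ord -(mulr_natl N) expr2.
  by apply: eq_bigr => a _; rewrite sumr_const card_ord.
rewrite /pair_count mulr_sumr -!sumrB -big_split /=; apply: eq_bigr => a _.
rewrite mulr_sumr -!sumrB -big_split /=; apply: eq_bigr => b _.
by case: (G a b); case: (c a == c b) => /=; lra.
Qed.

End colouring.

Variable gam : R.
Hypothesis gam0 : 0 < gam.
Hypothesis gamN : 2 <= gam * N.
Hypothesis few : map_density R (clique_maps G k.+2 setT) <= (gam / 2) ^+ k.+2.

Let q : R := (N ^+ 2)^-1 * pair_count G.

(** The clique threshold is g^(k+2) with g the integer part of gam N; the hypothesis on
    gam N makes g at least gam N / 2. *)
Lemma colouring_exists : exists c : 'I_n.+1 -> 'I_k.+1,
  q + (N ^+ 2)^-1 * pair_count (fun a b => G a b && (c a == c b))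
    + (N ^+ 2)^-1 * pair_count (fun a b => c a == c b) <= 1 + 2 * r * gam.
Proof.
have N0 : 0 < N by rewrite ltr0n.
have gN0 : 0 <= gam * N by rewrite mulr_ge0// ltW.
have [g gle ggt] : exists2 g : nat, g%:R <= gam * N & gam * N / 2 < g%:R.
  exists (Num.trunc (gam * N)); first by have /andP[] := truncn_itv gN0.
  have /andP[_] := truncn_itv gN0; rewrite -[(Num.trunc _).+1%:R]natr1.
  by move: gamN; set x := gam * N; set t : R := (Num.trunc x)%:R; lra.
have cl : (cliques G k.+2 setT < g ^ k.+2)%N.
  rewrite -(ltr_nat R); apply: le_lt_trans (_ : _ <= #|clique_maps G k.+2 setT|%:R) _.
    by rewrite ler_nat; exact: cliques_le_card.
  move: few; rewrite /map_density card_ord ler_pdivrMr; last by rewrite ltr0n expn_gt0.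
  move=> h; apply: le_lt_trans h _.
  rewrite !natrX -exprMn; apply: ltrXn2r; rewrite ?nnegrE//.
    by rewrite mulr_ge0 ?divr_ge0// ltW.
  by rewrite mulrAC.
have [c cP] := few_cliques_partition Gsym cl; exists c.
move: cP; rewrite edges_setT.
have E i : [set x in [set: 'I_n.+1] | c x == i] = [set x | c x == i].
  by apply/setP => x; rewrite !inE.
have -> : (\sum_i edges G [set x in setT | c x == i] [set x in setT | c x == i] =
    \sum_a \sum_b (G a b && (c a == c b) : nat))%N.
  by rewrite -sum_edges_colour; apply: eq_bigr => i _; rewrite E.
have -> : (\sum_i #|[set x in [set: 'I_n.+1] | c x == i]| ^ 2 = \sum_a \sum_b (c a == c
  b : nat))%N.
  by rewrite -sum_card_colour; apply: eq_bigr => i _; rewrite E.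
rewrite cardsT card_ord.
rewrite -(ler_nat R) !natrD !pair_count_nat !natrM -[N * N]expr2 => h.
rewrite /q -!mulrDr ler_pdivrMl ?exprn_gt0//; apply: le_trans h _.
rewrite mulrDr mulr1 lerD2l.
rewrite [leRHS](_ : _ = 2 * r * (gam * N) * N); last by ring.
by rewrite ler_pM2r// ler_pM2l// mulr_gt0 ?ltr0n.
Qed.

(** The proportion of pairs of equal colour is at least 1/r, by convexity. *)
Lemma edge_density_le : q <= 1 - r^-1 + 2 * r * gam.
Proof.
have [c cP] := colouring_exists.
have N0 : 0 < N ^+ 2 by rewrite exprn_gt0// ltr0n.
have : r^-1 <= (N ^+ 2)^-1 * pair_count (fun a b => c a == c b).
  rewrite ler_pdivlMl//.
  have : 0 <= \sum_i (#|[set a | c a == i]|%:R - M%:R : R) ^+ 2.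
    by apply: sumr_ge0 => i _; exact: sqr_ge0.
  by rewrite sum_sqr_dev subr_ge0.
have : 0 <= (N ^+ 2)^-1 * pair_count (fun a b => G a b && (c a == c b)).
  by rewrite mulr_ge0 ?invr_ge0 ?pair_count_ge0// ltW.
move: cP; set X := _ * pair_count _; set S := _ * pair_count _; set rg := 2 * r * gam.
set ri := r^-1; lra.
Qed.

(** Near equality in [edge_density_le], both the number X of monochromatic edges and
    the excess S - 1/r over balanced classes are small.  The pairs where G differs from
    the complete multipartite graph of the colouring are then few, and so are the cells
    whose colour disagrees with their block after the permutation of [perm_match]. *)
Lemma near_extremal (e1 al : R) : 0 < al -> 1 - r^-1 - e1 <= q ->
  exists s : {perm 'I_n.+1},
    (N ^+ 2)^-1 * pair_count (fun a b => G a b != (block (s a) != block (s b))) <=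
    3 * (e1 + 2 * r * gam) + 2 * (r * al + (e1 + 2 * r * gam) / al).
Proof.
move=> al0 q1; have [c cP] := colouring_exists.
have N0 : 0 < N by rewrite ltr0n.
have NN0 : 0 < N ^+ 2 by rewrite exprn_gt0.
set X := (N ^+ 2)^-1 * pair_count (fun a b => G a b && _) in cP.
set S := (N ^+ 2)^-1 * pair_count (fun a b => _ == _) in cP.
have X0 : 0 <= X.
  by rewrite mulr_ge0 ?invr_ge0 ?pair_count_ge0// ltW.
have dev : \sum_i (#|[set a | c a == i]|%:R - M%:R : R) ^+ 2 = N ^+ 2 * (S - r^-1).
  by rewrite sum_sqr_dev mulrBr /S mulrA mulfV ?mul1r// gt_eqF.
have S0 : r^-1 <= S.
  have : 0 <= N ^+ 2 * (S - r^-1).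
    by rewrite -dev; apply: sumr_ge0 => i _; exact: sqr_ge0.
  by rewrite pmulr_rge0// subr_ge0.
have [s sP] := perm_match c block; exists s.
pose mis : R := N^-1 * #|[set a | block (s a) != c a]|%:R.
have misle : mis <= r * al + (S - r^-1) / al.
  rewrite /mis ler_pdivrMl//.
  (* The bound |x| <= y + x^2 / y with y = al N converts the sum of the deviations of
     the class sizes into the sum of their squares. *)
  apply: le_trans (_ : \sum_i (al * N + (#|[set a | c a == i]|%:R - M%:R) ^+ 2 / (al *
    N)) <= _); last first.
    rewrite big_split /= sumr_const card_ord -mulr_suml dev -mulr_natl.
    by rewrite le_eqVlt; apply/orP; left; apply/eqP; field; rewrite !gt_eqF// nat1r ltr0n.
  apply: le_trans (_ : \sum_i (#|[set a | c a == i]| - #|[set a | block a == i]|)%N%:R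
    <= _).
    by rewrite -natr_sum ler_nat.
  apply: ler_sum => i _.
  have alN : 0 < al * N by rewrite mulr_gt0.
  set u := #|[set a | c a == i]|.
  have [uM|Mu] := leqP u #|[set a | block a == i]|.
    move: uM; rewrite -subn_eq0 => /eqP ->.
    by rewrite addr_ge0 ?divr_ge0 ?sqr_ge0 ?ltW.
  apply: le_trans (_ : (u%:R - M%:R) <= _).
    by rewrite natrB ?(ltnW Mu)// lerB// ler_nat card_block.
  set x := u%:R - _; set y := al * N in alN *.
  by rewrite -lerBlDl ler_pdivlMr//; have := sqr_ge0 (x - y); have := sqr_ge0 x;
    have := sqr_ge0 y; nra.
have -> : 3 * (e1 + 2 * r * gam) + 2 * (r * al + (e1 + 2 * r * gam) / al) =
   3 * (e1 + 2 * r * gam) + 2 * (r * al) + 2 * ((e1 + 2 * r * gam) / al) by ring.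
have dis := disagree_pair_count c.
have {}dis : (N ^+ 2)^-1 * pair_count (fun a b => G a b != (c a != c b)) = 1 - q - S +
  2 * X.
  by rewrite dis !mulrDr !mulrN mulVf ?gt_eqF// -/q -/S mulrCA -/X.
have dom (x y : bool) (w : R) : 1 <= w -> x%:R <= y%:R + w.
  by case: x; case: y => /=; lra.
have split_pair_count : (N ^+ 2)^-1 * pair_count (fun a b => G a b != (block (s a) !=
  block (s b)))
   <= (N ^+ 2)^-1 * pair_count (fun a b => G a b != (c a != c b)) + 2 * mis.
  have -> : 2 * mis = (N ^+ 2)^-1 * (pair_count (fun a _ => block (s a) != c a) +
    pair_count (fun _ b => block (s b) != c b)).
    have -> : pair_count (fun a _ => block (s a) != c a) = N * #|[set a | block (s a)
      != c a]|%:R.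
      rewrite /pair_count; under eq_bigr do rewrite sumr_const card_ord -(mulr_natl _ n.+1).
      rewrite -mulr_sumr; congr (_ * _); rewrite -sum1dep_card natr_sum [RHS]big_mkcond.
      by apply: eq_bigr => a _; case: (_ != _).
    have -> : pair_count (fun _ b => block (s b) != c b) = N * #|[set a | block (s a)
      != c a]|%:R.
      rewrite /pair_count sumr_const card_ord -[LHS]mulr_natl.
      congr (_ * _); rewrite -sum1dep_card natr_sum [RHS]big_mkcond.
      by apply: eq_bigr => a _; case: (_ != _).
    by rewrite /mis; field; rewrite nat1r gt_eqF.
  rewrite -mulrDr ler_pM2l ?invr_gt0// /pair_count -!big_split /=; apply: ler_sum => a _.
  rewrite -!big_split /=; apply: ler_sum => b _.
  have [ea|na] := eqVneq (block (s a)) (c a); have [eb|nb] := eqVneq (block (s b)) (c b).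
  - by rewrite ea eb /= addr0 addr0.
  - by apply: dom; rewrite /= add0r.
  - by apply: dom; rewrite /= addr0.
  - by apply: dom; rewrite /= lerDl.
apply: le_trans split_pair_count _; rewrite dis.
have : 0 <= 2 * r * gam by rewrite !mulr_ge0// ltW.
have SE : (S - r^-1) / al <= (e1 + 2 * r * gam) / al.
  rewrite ler_pM2r ?invr_gt0//; move: cP q1 X0; set ri := r^-1; set rg := 2 * r * gam; lra.
set Y := (e1 + 2 * r * gam) / al in SE *; set Z := r * al in misle *.
move: SE misle cP q1 S0 X0; set W := (S - r^-1) / al; set ri := r^-1; set rg := 2 * r * gam.
lra.
Qed.

End stability.

From mathcomp Require Import all_classical all_reals all_analysis.
From mathcomp Require Import measurable_realfun.

Import numFieldNormedType.Exports.

Local Open Scope classical_set_scope.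
Local Open Scope ring_scope.

(** * The tilted entropy *)

Section entropy.
Variable R : realType.
Implicit Types u q x beta : R.

Lemma ln_le_subr1 x : 0 < x -> ln x <= x - 1.
Proof. by move=> x0; have := @le_ln1Dx R (x - 1); rewrite [1 + _]addrC subrK; apply;
  lra. Qed.

Lemma ln_sqrt x : 0 < x -> ln x = 2 * ln (Num.sqrt x).
Proof.
move=> x0; rewrite -{1}(sqr_sqrtr (ltW x0)) lnXn ?sqrtr_gt0//.
by rewrite mulr_natl.
Qed.

(** A lower bound of Hellinger type for relative entropy: it is the inequality
    log x <= x - 1 at x = sqrt (q / u). *)
Lemma xlnx_ge u q : 0 <= u -> 0 < q ->
  u * ln q + 2 * u - 2 * (Num.sqrt u * Num.sqrt q) <= u * ln u.
Proof.
rewrite le_eqVlt => /predU1P[<- q0|u0 q0]; first by rewrite sqrtr0; lra.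
have a0 : 0 < Num.sqrt u by rewrite sqrtr_gt0.
have b0 : 0 < Num.sqrt q by rewrite sqrtr_gt0.
rewrite (ln_sqrt u0) (ln_sqrt q0) -{1 2 4}(sqr_sqrtr (ltW u0)).
move: a0 b0; set a := Num.sqrt u; set b := Num.sqrt q => a0 b0.
have := ln_le_subr1 (divr_gt0 b0 a0); rewrite ln_div ?posrE// => h.
have : a ^+ 2 * (ln b - ln a) <= a ^+ 2 * (b / a - 1) by rewrite ler_pM2l// exprn_gt0.
rewrite [leRHS](_ : _ = a * b - a ^+ 2); last by field; rewrite gt_eqF.
lra.
Qed.

(** The integrand of T - I without the term in t(H,h). *)
Definition tilt beta u : R := beta * u - Ient u.

Variable beta : R.
Let p := edge_prob beta.
Definition tilt_max : R := 2^-1 * ln (1 / (1 - p)).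

Lemma edge_prob_gt0 : 0 < p.
Proof. by have := expR_gt0 (2 * beta) => e; rewrite divr_gt0// addr_gt0. Qed.

Lemma onem_edge_prob : 1 - p = (1 + expR (2 * beta))^-1.
Proof.
have e := expR_gt0 (2 * beta).
by rewrite /p /edge_prob; field; rewrite gt_eqF// addr_gt0.
Qed.

Lemma edge_prob_lt1 : p < 1.
Proof.
by rewrite -subr_gt0 onem_edge_prob invr_gt0 addr_gt0 ?expR_gt0.
Qed.

Lemma ln_edge_prob : ln p = 2 * beta + ln (1 - p).
Proof.
have e := expR_gt0 (2 * beta).
rewrite -[2 * beta in RHS]expRK -lnM ?posrE ?subr_gt0 ?edge_prob_lt1//.
by rewrite onem_edge_prob.
Qed.

Lemma tilt_maxE : tilt_max = - (2^-1 * ln (1 - p)).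
Proof.
by rewrite /tilt_max div1r lnV ?posrE ?subr_gt0 ?edge_prob_lt1// mulrN.
Qed.

Lemma tilt_max_gt0 : 0 < tilt_max.
Proof.
rewrite tilt_maxE oppr_gt0 pmulr_rlt0 ?invr_gt0//; apply: ln_lt0.
by rewrite subr_gt0 edge_prob_lt1 ltrBlDr ltrDl edge_prob_gt0.
Qed.

(** The difference tilt_max - tilt u is half of the relative entropy of u with
    respect to p, which dominates half of (sqrt u - sqrt p)^2, hence (u - p)^2 / 8. *)
Lemma tilt_le u : 0 <= u <= 1 -> tilt beta u <= tilt_max - 8^-1 * (u - p) ^+ 2.
Proof.
move=> /andP[u0 u1]; have p0 := edge_prob_gt0; have p1 := edge_prob_lt1.
have h1 := xlnx_ge u0 p0.
have h2 := @xlnx_ge (1 - u) (1 - p) _ _.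
have {}h2 := h2 ltac:(lra) ltac:(lra).
rewrite /tilt /Ient tilt_maxE.
have p1' : 0 <= 1 - p by lra.
have u1' : 0 <= 1 - u by lra.
have -> : (u - p) ^+ 2 = (Num.sqrt u - Num.sqrt p) ^+ 2 * (Num.sqrt u + Num.sqrt p) ^+ 2.
  by rewrite -exprMn -subr_sqr !sqr_sqrtr// ltW.
move: h1 h2; rewrite ln_edge_prob; set l := ln (1 - p).
have su := sqr_sqrtr u0; have sp := sqr_sqrtr (ltW p0).
have su' := sqr_sqrtr u1'; have sp' := sqr_sqrtr p1'.
have := sqrtr_ge0 u; have := sqrtr_ge0 p.
have : Num.sqrt u <= 1 by rewrite -sqrtr1 ler_wsqrtr.
have : Num.sqrt p <= 1 by rewrite -sqrtr1 ler_wsqrtr// ltW.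
move: su sp su' sp'.
set a := Num.sqrt u; set b := Num.sqrt p; set a' := Num.sqrt (1 - u);
  set b' := Num.sqrt (1 - p).
move=> su sp su' sp' b1 a1 b0 a0 h1 h2.
have ab : (a - b) ^+ 2 * (a + b) ^+ 2 <= (a - b) ^+ 2 * 4.
  by apply: ler_wpM2l; [exact: sqr_ge0|nra].
have ab' : 0 <= (a' - b') ^+ 2 by exact: sqr_ge0.
have e1 : (a - b) ^+ 2 = u + p - 2 * (a * b) by rewrite -su -sp; ring.
have e2 : (a' - b') ^+ 2 = 2 - u - p - 2 * (a' * b').
  by rewrite sqrrB su' sp' -mulr_natl; lra.
rewrite e2 in ab'; rewrite {2}e1 in ab.
have : 8^-1 * ((a - b) ^+ 2 * (a + b) ^+ 2) <= 1 - a * b - a' * b' by lra.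
set Q := 8^-1 * _; move=> hQ.
lra.
Qed.

Lemma tilt_edge_prob : tilt beta p = tilt_max.
Proof. by rewrite /tilt /Ient tilt_maxE ln_edge_prob; lra. Qed.

Lemma tilt0 : tilt beta 0 = 0.
Proof. by rewrite /tilt /Ient subr0 ln1; lra. Qed.

Lemma tilt_le_sqrt u : 0 <= u <= 1 -> tilt beta u <= (2 + `|beta|) * Num.sqrt u.
Proof.
move=> /andP[]; rewrite le_eqVlt => /predU1P[<- _|u0 u1].
  by rewrite tilt0 sqrtr0 mulr0.
have a0 : 0 < Num.sqrt u by rewrite sqrtr_gt0.
have a1 : Num.sqrt u <= 1 by rewrite -sqrtr1 ler_wsqrtr.
have ua : u <= Num.sqrt u.
  by rewrite -{1}(sqr_sqrtr (ltW u0)) expr2 ler_piMl// ltW.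
have h1 : - (u * ln u) <= 2 * Num.sqrt u.
  have := @xlnx_ge u 1 (ltW u0) ltr01; rewrite ln1 sqrtr1 mulr0 mulr1 add0r; lra.
have h2 : - ((1 - u) * ln (1 - u)) <= u.
  have [->|un1] := eqVneq u 1; first by rewrite subrr mul0r; lra.
  have v0 : 0 < 1 - u by rewrite subr_gt0 lt_neqAle un1.
  have := ln_le_subr1 (x := (1 - u)^-1); rewrite invr_gt0 lnV ?posrE// => /(_ v0) h.
  have : (1 - u) * - ln (1 - u) <= (1 - u) * ((1 - u)^-1 - 1) by rewrite ler_pM2l.
  by rewrite mulrBr mulfV ?gt_eqF// mulrN; lra.
have h3 : beta * u <= `|beta| * Num.sqrt u.
  apply: le_trans (_ : `|beta| * u <= _).
    by apply: ler_wpM2r; [exact: ltW|exact: ler_norm].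
  by apply: ler_wpM2l.
rewrite /tilt /Ient; lra.
Qed.

End entropy.

(** * Integrals of bounded functions on the unit square *)

Section bounded_measurable.
Context d (T : measurableType d) (R : realType) (m : {measure set T -> \bar R}).
Variables (D : set T) (mD : measurable D) (finD : (m D < +oo)%E).
Implicit Types f g : T -> R.

Definition bdd_meas f := measurable_fun D f /\ exists M, forall x, D x -> `|f x| <= M.

Lemma bdd_meas_integrable f : bdd_meas f -> m.-integrable D (EFin \o f).
Proof.
move=> [mf [M fM]]; apply: measurable_bounded_integrable => //.
exists M; split; first exact: num_real.
by move=> N MN x Dx; apply: le_trans (fM x Dx) (ltW MN).
Qed.

Lemma bdd_meas_cst c : bdd_meas (fun=> c).
Proof. by split; [exact: measurable_cst|exists `|c|]. Qed.

Lemma bdd_measD f g : bdd_meas f -> bdd_meas g -> bdd_meas (fun x => f x + g x).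
Proof.
move=> [mf [M fM]] [mg [N gN]]; split; first exact: measurable_funD.
by exists (M + N) => x Dx; apply: le_trans (ler_normD _ _) (lerD (fM x Dx) (gN x Dx)).
Qed.

Lemma bdd_measM f g : bdd_meas f -> bdd_meas g -> bdd_meas (fun x => f x * g x).
Proof.
move=> [mf [M fM]] [mg [N gN]]; split; first exact: measurable_funM.
exists (M * N) => x Dx; rewrite normrM.
by apply: ler_pM => //; [exact: fM|exact: gN].
Qed.

Lemma bdd_measZ c f : bdd_meas f -> bdd_meas (fun x => c * f x).
Proof. by apply: bdd_measM; exact: bdd_meas_cst. Qed.

Lemma bdd_measB f g : bdd_meas f -> bdd_meas g -> bdd_meas (fun x => f x - g x).
Proof.
move=> bf /(@bdd_measZ (-1)) bg; have := bdd_measD bf bg.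
by congr bdd_meas; apply/funext => x /=; rewrite mulN1r.
Qed.

Lemma bdd_meas_norm f : bdd_meas f -> bdd_meas (fun x => `|f x|).
Proof.
move=> [mf [M fM]]; split; first exact: measurableT_comp.
by exists M => x Dx; rewrite normr_id; exact: fM.
Qed.

Lemma bdd_meas_sum (I : Type) (s : seq I) (f : I -> T -> R) :
  (forall i, bdd_meas (f i)) -> bdd_meas (fun x => \sum_(i <- s) f i x).
Proof.
move=> bf; elim: s => [|i s IH].
  by under eq_fun do rewrite big_nil; exact: bdd_meas_cst.
by under eq_fun do rewrite big_cons; exact: bdd_measD.
Qed.

Lemma bdd_meas_bool (b : T -> bool) : measurable [set x | b x] -> bdd_meas (fun x => (b
  x)%:R).
Proof.
move=> mb; split; last by exists 1 => x _; case: (b x); rewrite ?normr0 ?normr1.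
have mbf : measurable_fun setT b by apply: (measurable_fun_bool true); rewrite setTI.
rewrite (_ : (fun x => (b x)%:R) = (fun x => if b x then 1 else 0)); last first.
  by apply/funext => x; case: (b x).
by apply: measurable_funTS; apply: measurable_fun_ifT.
Qed.

Lemma bdd_meas_step (C : finType) (k : T -> C) (g : C -> R) :
  (forall c, measurable [set x | k x == c]) -> bdd_meas (fun x => g (k x)).
Proof.
move=> mk; have -> : (fun x => g (k x)) = (fun x => \sum_c g c * (k x == c)%:R).
  apply/funext => x; rewrite (bigD1 (k x))//= eqxx mulr1 big1 ?addr0//.
  by move=> c; rewrite eq_sym => /negbTE ->; rewrite mulr0.
by apply: bdd_meas_sum => c; apply/bdd_measZ/bdd_meas_bool.
Qed.

Lemma Rint_le f g : bdd_meas f -> bdd_meas g -> (forall x, D x -> f x <= g x) ->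
  \int[m]_(x in D) f x <= \int[m]_(x in D) g x.
Proof. by move=> bf bg; apply: le_Rintegral => //; exact: bdd_meas_integrable. Qed.

Lemma RintD f g : bdd_meas f -> bdd_meas g ->
  \int[m]_(x in D) (f x + g x) = \int[m]_(x in D) f x + \int[m]_(x in D) g x.
Proof. by move=> bf bg; apply: RintegralD => //; exact: bdd_meas_integrable. Qed.

Lemma RintZ c f : bdd_meas f ->
  \int[m]_(x in D) (c * f x) = c * \int[m]_(x in D) f x.
Proof. by move=> bf; apply: RintegralZl => //; exact: bdd_meas_integrable. Qed.

Lemma Rint_sum (I : Type) (s : seq I) (f : I -> T -> R) :
  (forall i, bdd_meas (f i)) ->
  \int[m]_(x in D) (\sum_(i <- s) f i x) = \sum_(i <- s) \int[m]_(x in D) f i x.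
Proof.
move=> bf; elim: s => [|i s IH].
  rewrite big_nil; under eq_Rintegral do rewrite big_nil.
  by rewrite Rintegral_cst// mul0r.
rewrite big_cons -IH -RintD//; last exact: bdd_meas_sum.
by apply: eq_Rintegral => x _; rewrite big_cons.
Qed.

Lemma Rint_bool (b : T -> bool) : measurable [set x | b x] ->
  \int[m]_(x in D) (b x)%:R = fine (m (D `&` [set x | b x])).
Proof.
move=> mb; rewrite setIC -integral_indic// /Rintegral; congr fine.
apply: eq_integral => x _; rewrite indicE; congr ((_ : bool)%:R%:E).
by apply/idP/idP; rewrite inE.
Qed.

Lemma Rint_step (C : finType) (k : T -> C) (g : C -> R) :
  (forall c, measurable [set x | k x == c]) ->
  \int[m]_(x in D) g (k x) = \sum_c g c * fine (m (D `&` [set x | k x == c])).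
Proof.
move=> mk.
transitivity (\int[m]_(x in D) (\sum_c g c * (k x == c)%:R)).
  apply: eq_Rintegral => x _; rewrite (bigD1 (k x))//= eqxx mulr1 big1 ?addr0//.
  by move=> c; rewrite eq_sym => /negbTE ->; rewrite mulr0.
rewrite Rint_sum; last by move=> c; apply/bdd_measZ/bdd_meas_bool.
by apply: eq_bigr => c _; rewrite RintZ ?Rint_bool//; exact: bdd_meas_bool.
Qed.

End bounded_measurable.

Section unit_square.
Variable R : realType.

Local Notation mu := (@lebesgue_measure R).
Local Notation mu2 := (mu \x mu)%E.
Local Notation I01 := (`[0%R, 1%R]%classic : set R).
Local Notation Sq := (I01 `*` I01).

Lemma mu_I01 : mu I01 = 1%E.
Proof. by rewrite lebesgue_measure_itv /= lte_fin ltr01 -EFinB subr0. Qed.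

Lemma fin_I01 : (mu I01 < +oo)%E. Proof. by rewrite mu_I01 ltry. Qed.

Lemma mu2_Sq : mu2 Sq = 1%E.
Proof.
transitivity (mu I01 * mu I01)%E; last by rewrite mu_I01 mule1.
by apply: product_measure1E; exact: measurable_I01.
Qed.

Lemma fin_Sq : (mu2 Sq < +oo)%E. Proof. by rewrite mu2_Sq ltry. Qed.

Definition area (A : set (R * R)) : R := fine (mu2 (Sq `&` A)).

Lemma area_fin (A : set (R * R)) : measurable A -> mu2 (Sq `&` A) \is a fin_num.
Proof.
move=> mA; rewrite ge0_fin_numE//; apply: le_lt_trans fin_Sq.
by apply: le_measure; rewrite ?inE//; [apply: measurableI|]; rewrite //;
  exact: measurable_sq.
Qed.

Lemma area_ge0 A : 0 <= area A.
Proof. exact: fine_ge0. Qed.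

(** Sub-additivity, in the form in which it bounds symmetric differences. *)
Lemma area_le2 (A B C : set (R * R)) : measurable A -> measurable B -> measurable C ->
  A `<=` B `|` C -> area A <= area B + area C.
Proof.
move=> mA mB mC ABC; rewrite /area -fineD ?area_fin//.
apply: fine_le; rewrite ?area_fin//; first by rewrite fin_numD !area_fin.
have mX Y : measurable Y -> measurable (Sq `&` Y) by move=> mY;
  exact: measurableI (@measurable_sq R) mY.
apply: le_trans (_ : (mu2 ((Sq `&` B) `|` (Sq `&` C)) <= _)%E); last first.
  by apply: measureU2; exact: mX.
apply: le_measure; rewrite ?inE; [exact: mX|apply: measurableU; exact: mX|].
by rewrite -setIUr; apply: setIS.
Qed.

Lemma area_set0 : area set0 = 0.
Proof. by rewrite /area setI0 measure0. Qed.

Lemma area_swap (A : set (R * R)) : measurable A ->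
  area [set z | A (z.2, z.1)] = area A.
Proof.
move=> mA; rewrite /area; congr fine.
pose RR := (measurableTypeR R * measurableTypeR R)%type.
pose sw (z : RR) : RR := (z.2, z.1).
have msw : measurable_fun [set: RR] sw by apply: measurable_fun_pair.
pose m' : {measure set RR -> \bar R} :=
  measure_function_pushforward__canonical__measure_function_Measure mu2 msw.
rewrite [RHS](_ : _ = m' (Sq `&` A)).
  rewrite /m' /= /pushforward; congr (mu2 _); apply/seteqP.
  by split => -[x y] /= [[? ?] ?].
apply: product_measure_unique; last by apply: measurableI => //; exact: measurable_sq.
move=> X Y mX mY; rewrite /m' /= /pushforward (_ : _ @^-1` _ = Y `*` X).
  by rewrite product_measure1E// muleC.
by apply/seteqP; split => -[x y] [].
Qed.

Section cells.
Variable n : nat.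
Implicit Types (x y : R) (a b : 'I_n.+1).

(** The index of the interval [a/(n+1), (a+1)/(n+1)[ that contains x.  The point 1, and
    every x outside of [0,1[, gets the default index 0; within [0,1] this concerns only
    the point 1, a null set. *)
Definition cell (x : R) : 'I_n.+1 := inord (Num.trunc (n.+1%:R * x)).

Let N : R := n.+1%:R.
Let N0 : 0 < N. Proof. by rewrite ltr0n. Qed.

Lemma cell_itv x : 0 <= x < 1 ->
  (cell x)%:R / n.+1%:R <= x < (cell x).+1%:R / n.+1%:R.
Proof.
move=> /andP[x0 x1]; have Nx : 0 <= N * x by rewrite mulr_ge0// ltW.
have /andP[h1 h2] := truncn_itv Nx.
rewrite /cell inordK.
  by rewrite ler_pdivrMr// ltr_pdivlMr// [x * _]mulrC h1 h2.
rewrite -(ltr_nat R); apply: le_lt_trans h1 _.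
by rewrite -[ltRHS]mulr1 ltr_pM2l.
Qed.

Lemma cell_eq x a : a%:R / n.+1%:R <= x < a.+1%:R / n.+1%:R -> cell x = a.
Proof.
rewrite ler_pdivrMr// ltr_pdivlMr// ![x * _]mulrC => /truncn_def h.
by rewrite /cell h inord_val.
Qed.

Lemma ord_itv a x : a%:R / n.+1%:R <= x < a.+1%:R / n.+1%:R -> 0 <= x < 1.
Proof.
move=> /andP[ax xa]; apply/andP; split.
  by apply: le_trans ax; rewrite divr_ge0// ler0n.
by apply: lt_le_trans xa _; rewrite ler_pdivrMr// mul1r ler_nat.
Qed.

Lemma measurable_cell a : measurable [set x | cell x == a].
Proof.
have -> : [set x | cell x == a] = [set x | (Num.trunc (N * x) == a) || 
    ((n.+1 <= Num.trunc (N * x))%N && (a == 0%N :> nat))].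
  apply/seteqP; split => x /=; rewrite -val_eqE /= /cell /inord /insubd;
    case: insubP => [u ltu ->|]; rewrite -?leqNgt.
  - by move->.
  - by move=> -> /eqP <-; rewrite orbT.
  - by rewrite (leqNgt n.+1) ltu orbF.
  - move=> h; case/orP => [/eqP e|/andP[_ /eqP ->]//].
    by have := ltn_ord a; rewrite -e ltnNge h.
have mt : measurable_fun [set: R] (fun x => (Num.trunc (N * x))%:R : R).
  apply: measurable_realfun.nondecreasing_measurable => //.
  by move=> x y xy; rewrite ler_nat; apply: le_truncn; rewrite ler_pM2l.
have mle k : measurable [set x | (k <= Num.trunc (N * x))%N].
  rewrite (_ : [set _ | _] = (fun x => (Num.trunc (N * x))%:R : R) @^-1` `[k%:R, +oo[).
    by rewrite -[X in measurable X]setTI; apply: mt.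
  by apply/seteqP; split => x /=; rewrite in_itv /= andbT ler_nat.
rewrite (_ : [set _ | _] = ([set x | (a <= Num.trunc (N * x))%N] `\` [set x | (a.+1 <=
  Num.trunc (N * x))%N])
   `|` (if a == 0%N :> nat then [set x | (n.+1 <= Num.trunc (N * x))%N] else set0)).
  apply: measurableU; first exact: measurableD.
  by case: ifP.
apply/seteqP; split => x /=.
  case/orP => [/eqP ->|/andP[h ->]]; last by right.
  by left; rewrite leqnn ltnn; split.
case=> [[h1 /negP]|].
  by rewrite -leqNgt => h2; rewrite eqn_leq h1 h2.
by case: ifP => // _ /= ->; rewrite orbT.
Qed.

Lemma mu_cell a : fine (mu (I01 `&` [set x | cell x == a])) = n.+1%:R^-1.
Proof.
pose J : set R := `[a%:R / n.+1%:R, a.+1%:R / n.+1%:R[%classic.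
have -> : I01 `&` [set x | cell x == a] = J `|` ([set 1] `&` [set x | cell x == a]).
  apply/seteqP; split => x /=.
    rewrite in_itv /= => -[/andP[x0]]; rewrite le_eqVlt => /predU1P[->|x1]; first by right.
    move=> /eqP xa; left; rewrite /J /= in_itv /= -xa.
    by apply: cell_itv; rewrite x0.
  rewrite !in_itv /=; case=> [h|[-> ->]]; last by rewrite ler01 lexx.
  by have /andP[x0 x1] := ord_itv h; rewrite x0 (ltW x1) (cell_eq h) eqxx.
have mJ : measurable J by exact: measurable_itv.
have m1 : measurable ([set 1] `&` [set x | cell x == a]).
  by apply: measurableI => //; exact: measurable_cell.
have -> : mu (J `|` ([set 1] `&` [set x | cell x == a])) = (mu J + mu ([set 1%R] `&`
  [set x | cell x == a]))%E.
  apply: measureU => //.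
  apply/seteqP; split => // x [/=]; rewrite /J /= in_itv /= => /ord_itv /andP[_ x1] [xe _].
  by rewrite xe ltxx in x1.
have -> : mu ([set 1] `&` [set x | cell x == a]) = 0%E.
  apply/eqP; rewrite eq_le measure_ge0 andbT -(lebesgue_measure_set1 (1 : R)).
  by apply: le_measure; rewrite ?inE//; exact: subIsetl.
rewrite adde0 /J lebesgue_measure_itv /= lte_fin ltr_pM2r ?invr_gt0// ltr_nat ltnS leqnn /=.
by rewrite -mulrBl -natrB ?leqnSn// subSnn mul1r.
Qed.

Definition cell2 (z : R * R) := (cell z.1, cell z.2).

Lemma cell2_pre c : [set z | cell2 z == c] = [set x | cell x == c.1] `*` [set y | cell
  y == c.2].
Proof. by apply/seteqP; split => -[x y]; rewrite /= /cell2 -pair_eqE /= => /andP. Qed.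

Lemma measurable_cell2 c : measurable [set z | cell2 z == c].
Proof. by rewrite cell2_pre; apply: measurableX; exact: measurable_cell. Qed.

Lemma area_cell2 c : area [set z | cell2 z == c] = (n.+1%:R ^+ 2)^-1.
Proof.
rewrite /area cell2_pre -setXI.
have mc a : measurable (I01 `&` [set x | cell x == a]).
  by apply: measurableI; [exact: measurable_I01|exact: measurable_cell].
have -> : mu2 ((I01 `&` [set x | cell x == c.1]) `*` (I01 `&` [set y | cell y == c.2])) =
    (mu (I01 `&` [set x | cell x == c.1]) * mu (I01 `&` [set y | cell y == c.2]))%E.
  by apply: product_measure1E; exact: mc.
have fin a : mu (I01 `&` [set x | cell x == a]) \is a fin_num.
  rewrite ge0_fin_numE//; apply: le_lt_trans fin_I01.
  by apply: le_measure; rewrite ?inE; [exact: mc|exact: measurable_I01|exact: subIsetl].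
by rewrite fineM// !mu_cell expr2 invfM.
Qed.

Lemma Rint_cell (g : 'I_n.+1 -> R) :
  \int[mu]_(x in I01) g (cell x) = n.+1%:R^-1 * \sum_a g a.
Proof.
rewrite (@Rint_step _ _ R mu I01 (@measurable_I01 R) fin_I01 _ _ g measurable_cell)
  mulr_sumr.
by apply: eq_bigr => a _; rewrite mu_cell mulrC.
Qed.

Lemma Rint_cell2 (g : 'I_n.+1 -> 'I_n.+1 -> R) :
  \int[mu2]_(z in Sq) g (cell z.1) (cell z.2) =
  (n.+1%:R ^+ 2)^-1 * \sum_a \sum_b g a b.
Proof.
rewrite (@Rint_step _ _ R mu2 Sq (@measurable_sq R) fin_Sq _ _ (fun c => g c.1 c.2)
  measurable_cell2).
rewrite pair_bigA mulr_sumr; apply: eq_bigr => c _.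
by rewrite -/(area _) area_cell2 mulrC.
Qed.

Definition gridset (G : rel 'I_n.+1) : set (R * R) := [set z | G (cell z.1) (cell z.2)].

Lemma measurable_gridset G : measurable (gridset G).
Proof.
rewrite (_ : gridset G = \bigcup_(c in [set` [pred c | G c.1 c.2]]) [set z | cell2 z == c]).
  apply: fin_bigcup_measurable; first exact: finite_finset.
  by move=> c _; exact: measurable_cell2.
apply/seteqP; split => [z h|z [c + /eqP e]].
  by exists (cell2 z) => //=; rewrite inE.
by rewrite /= -e inE.
Qed.

End cells.

Definition grid_approx (A : set (R * R)) := forall e : R, 0 < e ->
  exists n0, forall n, (n0 <= n)%N -> exists G : rel 'I_n.+1, area (A `+` gridset G) <= e.

End unit_square.

(** * Approximation of measurable sets by grids *)

Section grid_approximation.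
Variable R : realType.

Local Notation mu := (@lebesgue_measure R).
Local Notation mu2 := (mu \x mu)%E.
Local Notation I01 := (`[0%R, 1%R]%classic : set R).
Local Notation Sq := (I01 `*` I01).
Implicit Types A B : set (R * R).

Lemma measurable_setY A B : measurable A -> measurable B -> measurable (A `+` B).
Proof. by move=> mA mB; apply: measurableU; apply: measurableD. Qed.

Lemma grid_approx_set0 : grid_approx (set0 : set (R * R)).
Proof.
move=> e e0; exists 0%N => n _; exists (fun _ _ => false).
rewrite (_ : _ `+` _ = set0) ?area_set0 ?ltW//.
by apply/seteqP; split => z //= [[]|[]].
Qed.

Lemma grid_approxC A : grid_approx A -> grid_approx (~` A).
Proof.
move=> aA e e0; have [n0 H] := aA e e0; exists n0 => n /H[G GA].
exists (fun a b => ~~ G a b).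
rewrite (_ : _ `+` _ = A `+` gridset G)//.
apply/seteqP; split => z /=.
  by case=> [[nA /negP]|[/negP nG /contrapT]]; [rewrite negbK; right|left].
by case=> [[zA nG]|[zG nA]]; [right|left]; split => //; apply/negP => //; rewrite negbK.
Qed.

Lemma grid_approxU A B : measurable A -> measurable B ->
  grid_approx A -> grid_approx B -> grid_approx (A `|` B).
Proof.
move=> mA mB aA aB e e0; have e2 : 0 < e / 2 by rewrite divr_gt0.
have [n1 HA] := aA _ e2; have [n2 HB] := aB _ e2.
exists (maxn n1 n2) => n; rewrite geq_max => /andP[/HA[G GA] /HB[K KB]].
exists (fun a b => G a b || K a b).
rewrite [e]splitr; apply: le_trans (lerD GA KB).
have mG := measurable_gridset (R := R) G; have mK := measurable_gridset (R := R) K.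
apply: area_le2; try by apply: measurable_setY.
  by apply: measurable_setY; [exact: measurableU|exact: measurable_gridset].
move=> z /=; case=> [[[zA|zB] /negP]|].
- by rewrite negb_or => /andP[/negP nG _]; left; left.
- by rewrite negb_or => /andP[_ /negP nG]; right; left.
by case=> /orP[zG|zK] /not_orP[nA nB]; [left; right|right; right].
Qed.

(** A finite union exhausts the countable union up to measure e / 2, since the square
    has finite measure. *)
Lemma grid_approx_bigcup (F : (set (R * R))^nat) : (forall k, measurable (F k)) ->
  (forall k, grid_approx (F k)) -> grid_approx (\bigcup_k F k).
Proof.
move=> mF aF e e0; have e2 : 0 < e / 2 by rewrite divr_gt0.
pose B K := \big[setU/set0]_(k < K) F k.
have mB K : measurable (B K) by apply: bigsetU_measurable.
have aB K : grid_approx (B K).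
  elim: K => [|K IH]; first by rewrite /B big_ord0; exact: grid_approx_set0.
  by rewrite /B big_ord_recr; apply: grid_approxU => //; exact: mB.
have mU : measurable (\bigcup_k F k) by exact: bigcup_measurable.
pose T K := Sq `&` (\bigcup_k F k `\` B K).
have mT K : measurable (T K).
  by apply: measurableI; [exact: measurable_sq|exact: measurableD].
have T0 : \bigcap_K T K = set0.
  apply/seteqP; split => // z zT; have [_ [[k _ Fkz] _]] := zT 0%N I.
  have [_ [_]] := zT k.+1 I; apply; rewrite /B -bigcup_mkord.
  by exists k => //=.
have : (mu2 \o T) K @[K --> \oo] --> mu2 (\bigcap_K T K).
  apply: nonincreasing_cvg_mu => //.
  - apply: le_lt_trans (fin_Sq R); apply: le_measure; rewrite ?inE;
    [exact: mT|exact: measurable_sq|exact: subIsetl].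
  - by rewrite T0.
  - move=> K L KL; rewrite subsetEset; apply: setIS; apply: setDS.
    by rewrite /B -!bigcup_mkord => z [k /= kK]; exists k => //=; exact: (leq_trans kK KL).
rewrite T0 measure0 => /fine_cvgP[_ /cvgrPdist_lt/(_ _ e2)[K _ /(_ K (leqnn K))]] /=.
rewrite sub0r normrN => TK.
have {}TK : area (\bigcup_k F k `\` B K) <= e / 2.
  by apply: ltW; apply: le_lt_trans TK; rewrite ler_norm.
have [n0 H] := aB K _ e2; exists n0 => n /H[G GB]; exists G.
rewrite [e]splitr addrC; apply: le_trans (lerD GB TK).
have mG := measurable_gridset (R := R) G.
apply: area_le2; [exact: measurable_setY..|exact: measurableD|].
move=> z [[Uz nG]|[zG nU]].
  have [Bz|nB] := pselect (B K z); first by left; left.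
  by right.
left; right; split=> //; rewrite /B -bigcup_mkord => -[k _ Fk].
by apply: nU; exists k.
Qed.

Lemma measurable_strip (u v : R) :
  measurable [set z : R * R | u <= z.1 <= v] /\
  measurable [set z : R * R | u <= z.2 <= v].
Proof.
have mJ : measurable `[u, v]%classic by exact: measurable_itv.
split.
  rewrite (_ : [set _ | _] = `[u, v]%classic `*` setT); first exact: measurableX.
  by apply/seteqP; split => -[x y] /=; rewrite in_itv /=; [move=> ->|case].
rewrite (_ : [set _ | _] = setT `*` `[u, v]%classic); first exact: measurableX.
by apply/seteqP; split => -[x y] /=; rewrite in_itv /=; [move=> ->|case].
Qed.

Lemma area_strip (u v : R) : u <= v ->
  area ([set z | u <= z.1 <= v]) <= v - u /\ area ([set z | u <= z.2 <= v]) <= v - u.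
Proof.
move=> uv.
have mJ : measurable `[u, v]%classic by exact: measurable_itv.
have [mS _] := measurable_strip u v.
have h : area ([set z | u <= z.1 <= v]) <= v - u.
  rewrite /area (_ : _ `&` _ = (I01 `&` `[u, v]%classic) `*` I01); last first.
    apply/seteqP; split => -[x y] /=; rewrite !in_itv /=.
      by move=> [[-> ->] ->].
    by move=> [[-> ->] ->].
  have mIJ : measurable (I01 `&` `[u, v]) by apply: measurableI => //;
    exact: measurable_I01.
  have -> : mu2 ((I01 `&` `[u, v]%classic) `*` I01) = (mu (I01 `&` `[u, v]) * mu I01)%E.
    by apply: product_measure1E => //; exact: measurable_I01.
  rewrite mu_I01 mule1 -[leRHS]/(fine (v - u)%:E).
  have muJ : mu `[u, v]%classic = (v - u)%:E.
    rewrite lebesgue_measure_itv /= lte_fin; case: ltP => // vu.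
    by rewrite (@le_anti _ _ u v) ?subrr// uv vu.
  have le : (mu (I01 `&` `[u, v]) <= (v - u)%:E)%E.
    by rewrite -muJ; apply: le_measure; rewrite ?inE//; exact: subIsetr.
  by apply: fine_le => //; rewrite ge0_fin_numE//; apply: le_lt_trans le (ltry _).
by split=> //; rewrite -(area_swap mS) in h.
Qed.

(** The grid can only be wrong on a strip of width 1/(n+1), and on the line x = 1. *)
Lemma grid_approx_ray (x : R) :
  grid_approx (`]x, +oo[%classic `*` setT) /\ grid_approx (setT `*` `]x, +oo[%classic).
Proof.
have key (e : R) n : 0 < e -> 2 / n.+1%:R < e -> 
  area ((`]x, +oo[%classic `*` setT) `+` gridset (fun a _ : 'I_n.+1 => x < a%:R /
    n.+1%:R)) <= e.
  move=> e0 ne; set A := _ `*` _; set G := gridset _.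
  have N0 : 0 < n.+1%:R :> R by rewrite ltr0n.
  have i0 : 0 < n.+1%:R^-1 :> R by rewrite invr_gt0.
  have mA : measurable A by apply: measurableX => //; exact: measurable_itv.
  have mG : measurable G by exact: measurable_gridset.
  have xx : x <= x + n.+1%:R^-1 by rewrite lerDl ltW.
  have [s1 _] := area_strip xx; have [s2 _] := area_strip (lexx (1 : R)).
  have mS u v : measurable [set z : R * R | u <= z.1 <= v].
    by have [] := measurable_strip u v.
  have mZ : measurable (Sq `&` (A `+` G)).
    by apply: measurableI; [exact: measurable_sq|exact: measurable_setY].
  have -> : area (A `+` G) = area (Sq `&` (A `+` G)) by rewrite /area setIA setIid.
  apply: le_trans (_ : (x + n.+1%:R^-1 - x) + (1 - 1) <= _); last first.
    by move: ne i0; set i := _^-1; lra.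
  apply: le_trans (lerD s1 s2); apply: area_le2 => //.
  move=> [u v]; rewrite /setI /= => -[[]]; rewrite !in_itv /= => /andP[u0 u1] _ h.
  have [->|un] := eqVneq u 1; first by right; rewrite lexx.
  left; have {}u1 : 0 <= u < 1 by rewrite u0 lt_neqAle un.
  have /andP[c1 c2] := cell_itv n u1; move: h.
  have c2' : u < (cell n u)%:R / n.+1%:R + n.+1%:R^-1.
    by apply: lt_le_trans c2 _; rewrite -natr1 mulrDl mul1r.
  rewrite /setY /setU /setD /gridset /A /G /= in_itv /= andbT.
  case=> [[[xu _] /negP]|[xc /not_andP[/negP|//]]]; rewrite -leNgt.
    by move=> cx; rewrite ltW//= ltW//; apply: lt_le_trans c2' _; rewrite lerD2r.
  by move=> ux; have := le_lt_trans ux xc; rewrite ltNge c1.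
have swp (e : R) n : 0 < e -> 2 / n.+1%:R < e -> 
  area ((setT `*` `]x, +oo[%classic) `+` gridset (fun _ a : 'I_n.+1 => x < a%:R /
    n.+1%:R)) <= e.
  move=> e0 ne; have := key e n e0 ne; rewrite -area_swap; last first.
    apply: measurable_setY; last exact: measurable_gridset.
    by apply: measurableX => //; exact: measurable_itv.
  congr (_ <= _); congr area; apply/seteqP; split => -[a b];
    rewrite /setY /setU /setD /gridset /=.
    by move=> [[[? _] ?]|[? nh]]; [left|right] => //; split=> // -[_ ?]; apply: nh.
  by move=> [[[_ ?] ?]|[? nh]]; [left|right] => //; split=> // -[? _]; apply: nh.
have ev (e : R) : 0 < e -> exists n0, forall n, (n0 <= n)%N -> 2 / n.+1%:R < e.
  move=> e0; exists (Num.bound (2 / e)) => n hn.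
  rewrite ltr_pdivrMr ?ltr0n// mulrC -ltr_pdivrMr//.
  apply: lt_le_trans (archi_boundP _) _; first by rewrite divr_ge0// ltW.
  by rewrite ler_nat; apply: leq_trans hn _.
split=> e e0; have [n0 H] := ev e e0; exists n0 => n /H ne; eexists.
  exact: key.
exact: swp.
Qed.

(** The sets that every fine enough grid approximates form a sigma-algebra, which
    contains the half-planes.  Asking for all fine grids, rather than for some, makes
    two approximations live on the same grid, and leaves the number of cells free to be
    a multiple of r. *)
Theorem measurable_grid_approx A : measurable A -> grid_approx A.
Proof.
have one (A' : set R) : measurable A' ->
    grid_approx (A' `*` setT) /\ grid_approx (setT `*` A').
  move=> mA'; suff : [set X : set R | measurable X /\ (grid_approx (X `*` setT) /\
    grid_approx (setT `*` X))] A' by case.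
  have mA2 : measurable (A' : set (measurableTypeR R)) by exact: mA'.
  move: mA2; rewrite RGenOInfty.measurableE; apply.
  split.
    split.
    - split; first exact: measurable0.
      by rewrite set0X setX0; split; exact: grid_approx_set0.
    - move=> X [mX [X1 X2]]; rewrite setTD; split; first exact: measurableC.
      have -> : (~` X) `*` [set: R] = ~` (X `*` setT).
        by apply/seteqP; split => -[a b] /=; [move=> [? _] [? _]|move=> h; split=> //
          ?; apply: h].
      have -> : [set: R] `*` (~` X) = ~` (setT `*` X).
        by apply/seteqP; split => -[a b] /=; [move=> [_ ?] [_ ?]|move=> h; split=> //
          ?; apply: h].
      by split; exact: grid_approxC.
    - move=> F HF; split; first by apply: bigcupT_measurable => k; case: (HF k).
      rewrite setX_bigcupr setX_bigcupl; split; apply: grid_approx_bigcup => k.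
      + by apply: measurableX => //; case: (HF k).
      + by case: (HF k) => _ [].
      + by apply: measurableX => //; case: (HF k).
      + by case: (HF k) => _ [].
  move=> _ [x ->]; split; first exact: measurable_itv.
  exact: grid_approx_ray.
move=> mA; suff : [set X : set (R * R) | measurable X /\ grid_approx X] A by case.
rewrite measurable_prod_measurableType in mA; apply: mA; split.
  split.
  - by split; [exact: measurable0|exact: grid_approx_set0].
  - by move=> X [mX aX]; rewrite setTD; split; [exact: measurableC|exact: grid_approxC].
  - move=> F HF; split; first by apply: bigcupT_measurable => k; case: (HF k).
    by apply: grid_approx_bigcup => k; case: (HF k).
move=> _ [X mX] [Y mY] <-.
split; first exact: measurableX.
have [X1 _] := one _ mX; have [_ Y2] := one _ mY.
have -> : X `*` Y = ~` ((~` (X `*` setT)) `|` (~` (setT `*` Y))).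
  rewrite -setCI setCK; apply/seteqP; split => -[a b] /=; first by move=> [].
  by move=> [[? _] [_ ?]].
have m1 : measurable (~` (X `*` [set: R])).
  by apply: measurableC; apply: measurableX.
have m2 : measurable (~` ([set: R] `*` Y)).
  by apply: measurableC; apply: measurableX.
by apply: grid_approxC; apply: grid_approxU => //; exact: grid_approxC.
Qed.

End grid_approximation.

(** * Iterated integrals over the cube *)

Section cube_integral.
Variable R : realType.

Local Notation mu := (@lebesgue_measure R).
Local Notation mu2 := (mu \x mu)%E.
Local Notation I01 := (`[0%R, 1%R]%classic : set R).
Local Notation Sq := (I01 `*` I01).

Lemma Rint_I01_cst c : \int[mu]_(_ in I01) c = c.
Proof.
transitivity (c * fine (mu I01)); last by rewrite mu_I01 mulr1.
exact: (Rintegral_cst mu (@measurable_I01 R)).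
Qed.

Definition in_cube m (t : m.-tuple R) := forall i, I01 (tnth t i).

Lemma in_cube_cons m x (t : m.-tuple R) : I01 x -> in_cube t -> in_cube [tuple of x :: t].
Proof.
move=> Ix It i; case: (unliftP ord0 i) => [j|] ->; last by rewrite tnth0.
by rewrite tnthS.
Qed.

Lemma eq_cube_int m (F G : m.-tuple R -> R) :
  (forall t, in_cube t -> F t = G t) -> cube_int F = cube_int G.
Proof.
elim: m F G => [|m IH] F G FG /=; first by apply: FG => -[].
apply: eq_Rintegral => x /set_mem Ix; apply: IH => t It; apply: FG.
exact: in_cube_cons.
Qed.

(** Boundedness and measurability are global here, as Tonelli's theorem asks for, so
    graphons have to be extended by 0 outside of the square. *)
Definition nneg_bdd_meas d (T : measurableType d) (F : T -> R) :=
  [/\ measurable_fun setT F, forall x, 0 <= F x & exists M, forall x, F x <= M].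

Lemma nneg_bdd_meas_bdd_meas d (T : measurableType d) (F : T -> R) D : nneg_bdd_meas F
  -> bdd_meas D F.
Proof.
move=> [mF F0 [M FM]]; split; first exact: measurable_funTS.
by exists M => x _; rewrite ger0_norm.
Qed.

Lemma nneg_bdd_meas_section d (T : measurableType d) (K : T * R -> R) : nneg_bdd_meas K ->
  nneg_bdd_meas (fun y => \int[mu]_(x in I01) K (y, x)).
Proof.
move=> [mK K0 [M KM]].
have bK y : bdd_meas I01 (fun x => K (y, x)).
  apply: nneg_bdd_meas_bdd_meas; split => //; last by exists M.
  exact: measurableT_comp mK (pair1_measurable y).
split.
- pose K' (z : T * R) : \bar R := (K z * (z.2 \in I01)%:R)%:E.
  have mK' : measurable_fun setT K'.
    apply/measurable_EFinP; apply: measurable_funM => //.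
    have := @bdd_meas_bool _ (T * R)%type R setT (fun z => z.2 \in I01).
    case=> //; rewrite (_ : [set _ | _] = setT `*` I01).
      by apply: measurableX => //; exact: (@measurable_I01 R).
    by apply/seteqP; split => -[a b] /=; rewrite inE; [|case].
  have K'0 z : (0 <= K' z)%E by rewrite lee_fin mulr_ge0 ?ler0n.
  have mF := @measurable_fun_fubini_tonelli_F _ _ _ _ _ mu K' mK' K'0.
  rewrite (_ : (fun y => _) = fine \o fubini_F mu K'); last first.
    apply/funext => y; rewrite /= /Rintegral; congr fine.
    rewrite integral_mkcond /fubini_F; apply: eq_integral => x _.
    rewrite /K' /= patchE; case: ifP => _ /=; first by rewrite mulr1.
    by rewrite mulr0.
  by apply: measurableT_comp mF; exact: fine_measurable.
- by move=> y; apply: Rintegral_ge0.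
- exists M => y; rewrite -[leRHS]Rint_I01_cst;
  apply: (@Rint_le _ _ R mu I01 (@measurable_I01 R) (fin_I01 R) (fun x => K (y, x))
  (fun=> M)).
  + exact: bK.
  + exact: bdd_meas_cst.
  + by move=> x _; exact: KM.
Qed.

Lemma nneg_bdd_meas_comp d d' (T : measurableType d) (T' : measurableType d') (F : T ->
  R) (g : T' -> T) :
  nneg_bdd_meas F -> measurable_fun setT g -> nneg_bdd_meas (F \o g).
Proof.
move=> [mF F0 [M FM]] mg; split; [exact: measurableT_comp|by move=> x; apply: F0|].
by exists M => x; apply: FM.
Qed.

(** The parameter y makes the induction go through: each integration moves one
    coordinate from the tuple to the parameter. *)
Lemma nneg_bdd_meas_cube_int d (T : measurableType d) m (F : T * (m.-tuple R) -> R) :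
  nneg_bdd_meas F ->
  nneg_bdd_meas (fun y => cube_int (fun t => F (y, t))).
Proof.
elim: m d T F => [|m IH] d T F nF /=.
  apply: (nneg_bdd_meas_comp nF).
  by apply: measurable_fun_pair => //; exact: measurable_cst.
pose K (z : (T * R) * (m.-tuple R)) := F (z.1.1, [tuple of z.1.2 :: z.2]).
have nK : nneg_bdd_meas K.
  apply: (nneg_bdd_meas_comp nF); apply: measurable_fun_pair.
    exact: measurableT_comp measurable_fst measurable_fst.
  apply: (measurable_cons (f := fun z : (T * R) * (m.-tuple R) => z.1.2) (g := fun z =>
    z.2)).
    exact: measurableT_comp measurable_snd measurable_fst.
  exact: measurable_snd.
exact: (nneg_bdd_meas_section (IH _ _ K nK)).
Qed.

Lemma nneg_bdd_meas_cons m (F : m.+1.-tuple R -> R) : nneg_bdd_meas F ->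
  nneg_bdd_meas (fun z : R * m.-tuple R => F [tuple of z.1 :: z.2]).
Proof.
move=> nF; apply: (nneg_bdd_meas_comp nF).
by apply: (measurable_cons (f := fst) (g := snd)).
Qed.

Lemma nneg_bdd_meas_cons1 m (F : m.+1.-tuple R -> R) x : nneg_bdd_meas F ->
  nneg_bdd_meas (fun t : m.-tuple R => F [tuple of x :: t]).
Proof.
move=> /nneg_bdd_meas_cons nF.
exact: (nneg_bdd_meas_comp nF (pair1_measurable x)).
Qed.

Lemma bdd_meas_cube_int m (F : m.+1.-tuple R -> R) : nneg_bdd_meas F ->
  bdd_meas I01 (fun x => cube_int (fun t => F [tuple of x :: t])).
Proof. by move=> nF; apply: nneg_bdd_meas_bdd_meas;
  exact: (nneg_bdd_meas_cube_int (nneg_bdd_meas_cons nF)). Qed.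

Lemma le_cube_int m (F G : m.-tuple R -> R) : nneg_bdd_meas F -> nneg_bdd_meas G ->
  (forall t, in_cube t -> F t <= G t) -> cube_int F <= cube_int G.
Proof.
elim: m F G => [|m IH] F G nF nG FG /=; first by apply: FG => -[].
apply: (@Rint_le _ _ R mu I01 (@measurable_I01 R) (fin_I01 R));
  [exact: bdd_meas_cube_int..|].
move=> x Ix; apply: IH; [exact: nneg_bdd_meas_cons1..|].
by move=> t It; apply: FG; exact: in_cube_cons.
Qed.

Lemma cube_int_ge0 m (F : m.-tuple R -> R) : (forall t, in_cube t -> 0 <= F t) -> 0 <=
  cube_int F.
Proof.
elim: m F => [|m IH] F F0 /=; first by apply: F0 => -[].
apply: Rintegral_ge0 => x Ix; apply: IH => t It; apply: F0.
exact: in_cube_cons.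
Qed.

Lemma cube_intD m (F G : m.-tuple R -> R) : nneg_bdd_meas F -> nneg_bdd_meas G ->
  cube_int (fun t => F t + G t) = cube_int F + cube_int G.
Proof.
elim: m F G => [|m IH] F G nF nG //=.
rewrite -(@RintD _ _ R mu I01 (@measurable_I01 R) (fin_I01 R));
  [|exact: bdd_meas_cube_int..].
by apply: eq_Rintegral => x _; rewrite IH//; exact: nneg_bdd_meas_cons1.
Qed.

Lemma cube_intZ m (F : m.-tuple R -> R) c : nneg_bdd_meas F ->
  cube_int (fun t => c * F t) = c * cube_int F.
Proof.
elim: m F => [|m IH] F nF //=.
rewrite -(@RintZ _ _ R mu I01 (@measurable_I01 R) (fin_I01 R));
  last exact: bdd_meas_cube_int.
by apply: eq_Rintegral => x _; rewrite IH//; exact: nneg_bdd_meas_cons1.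
Qed.

Lemma cube_int_cst m c : cube_int (fun _ : m.-tuple R => c) = c.
Proof.
elim: m => [//|m IH] /=.
rewrite (@eq_Rintegral _ _ _ mu I01 (cst c)); last by move=> x _; rewrite IH.
exact: Rint_I01_cst.
Qed.

Lemma nneg_bdd_meas_cst d (T : measurableType d) c : 0 <= c -> nneg_bdd_meas (fun _ : T
  => c).
Proof. by move=> c0; split => //; exists c. Qed.

Lemma nneg_bdd_measD d (T : measurableType d) (F G : T -> R) : nneg_bdd_meas F ->
  nneg_bdd_meas G -> nneg_bdd_meas (fun x => F x + G x).
Proof.
move=> [mF F0 [M FM]] [mG G0 [N GN]]; split.
- exact: measurable_funD.
- by move=> x; rewrite addr_ge0.
- by exists (M + N) => x; rewrite lerD.
Qed.

Lemma nneg_bdd_measM d (T : measurableType d) (F G : T -> R) : nneg_bdd_meas F ->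
  nneg_bdd_meas G -> nneg_bdd_meas (fun x => F x * G x).
Proof.
move=> [mF F0 [M FM]] [mG G0 [N GN]]; split.
- exact: measurable_funM.
- by move=> x; rewrite mulr_ge0.
- by exists (M * N) => x; rewrite ler_pM.
Qed.

Lemma nneg_bdd_meas_bool d (T : measurableType d) (b : T -> bool) :
  measurable [set x | b x] -> nneg_bdd_meas (fun x => (b x)%:R : R).
Proof.
move=> mb; have [mf _] := @bdd_meas_bool _ _ R setT b mb.
by split; [exact: mf|move=> x; exact: ler0n|exists 1 => x; case: (b x)].
Qed.

Lemma nneg_bdd_meas_prod d (T : measurableType d) (I : Type) (s : seq I) (P : pred I)
  (F : I -> T -> R) :
  (forall i, nneg_bdd_meas (F i)) -> nneg_bdd_meas (fun x => \prod_(i <- s | P i) F i x).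
Proof.
move=> nF; elim: s => [|i s IH].
  by under eq_fun do rewrite big_nil; exact: nneg_bdd_meas_cst.
under eq_fun do rewrite big_cons; case: (P i) => //; exact: nneg_bdd_measM.
Qed.

Lemma nneg_bdd_meas_sum d (T : measurableType d) (I : Type) (s : seq I) (P : pred I) (F
  : I -> T -> R) :
  (forall i, nneg_bdd_meas (F i)) -> nneg_bdd_meas (fun x => \sum_(i <- s | P i) F i x).
Proof.
move=> nF; elim: s => [|i s IH].
  by under eq_fun do rewrite big_nil; exact: nneg_bdd_meas_cst.
under eq_fun do rewrite big_cons; case: (P i) => //; exact: nneg_bdd_measD.
Qed.

Lemma cube_int_sum m (I : Type) (s : seq I) (P : pred I) (F : I -> m.-tuple R -> R) :
  (forall i, nneg_bdd_meas (F i)) ->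
  cube_int (fun t => \sum_(i <- s | P i) F i t) = \sum_(i <- s | P i) cube_int (F i).
Proof.
move=> nF; elim: s => [|i s IH].
  by rewrite big_nil -[RHS](cube_int_cst m); apply: eq_cube_int => t _; rewrite big_nil.
rewrite big_cons (eq_cube_int (G := fun t => if P i then F i t + \sum_(j <- s | P j) F
  j t else \sum_(j <- s | P j) F j t)).
  by case: (P i); rewrite // cube_intD ?IH//; exact: nneg_bdd_meas_sum.
by move=> t _; rewrite big_cons.
Qed.

Lemma nneg_bdd_meas_coords m (D : R * R -> R) (i j : 'I_m) : nneg_bdd_meas D ->
  nneg_bdd_meas (fun t : m.-tuple R => D (tnth t i, tnth t j)).
Proof.
move=> nD; apply: (nneg_bdd_meas_comp nD).
by apply: measurable_fun_pair; exact: measurable_tnth.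
Qed.

Lemma cube_int_coord m (f : R -> R) (i : 'I_m) :
  cube_int (fun t : m.-tuple R => f (tnth t i)) = \int[mu]_(x in I01) f x.
Proof.
elim: m i => [[]//|m IH] i /=.
case: (unliftP ord0 i) => [j|] ->.
  rewrite (@eq_Rintegral _ _ _ mu I01 (cst (\int[mu]_(x in I01) f x))).
    exact: Rint_I01_cst.
  by move=> x _; rewrite -(IH j) /=; apply: eq_cube_int => t _; rewrite tnthS.
apply: eq_Rintegral => x _; rewrite -[RHS](cube_int_cst m).
by apply: eq_cube_int => t _; rewrite tnth0.
Qed.

Lemma Rint_square (D : R * R -> R) : nneg_bdd_meas D ->
  \int[mu2]_(z in Sq) D z = \int[mu]_(x in I01) \int[mu]_(y in I01) D (x, y).
Proof.
move=> nD; have [mD D0 [M DM]] := nD.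
pose D' (z : R * R) : \bar R := (D z * ((z.1 \in I01) && (z.2 \in I01))%:R)%:E.
have mD' : measurable_fun setT D'.
  apply/measurable_EFinP; apply: measurable_funM => //.
  have := @bdd_meas_bool _ (R * R)%type R setT (fun z => (z.1 \in I01) && (z.2 \in I01)).
  case=> //; rewrite (_ : [set _ | _] = Sq); first exact: measurable_sq.
  apply/seteqP; split => -[a b] /=; first by move=> /andP[/set_mem ? /set_mem ?].
  by move=> [? ?]; rewrite !mem_set.
have D'0 z : (0 <= D' z)%E by rewrite lee_fin mulr_ge0 ?ler0n.
have E := @fubini_tonelli1 _ _ _ _ _ mu mu D' mD' D'0.
rewrite [LHS]/Rintegral [in LHS]integral_mkcond.
transitivity (fine (\int[mu2]_z D' z)%E).
  congr fine; apply: eq_integral => -[x y] _; rewrite patchE /D'.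
  rewrite (_ : ((x, y) \in Sq) = (x \in I01) && (y \in I01)); last by rewrite in_setX.
  by case: ifP => _; rewrite ?mulr1 ?mulr0.
rewrite E; congr fine; rewrite [RHS]integral_mkcond.
apply: eq_integral => x _; rewrite /fubini_F patchE /D' /=.
case: ifP => Ix /=; last first.
  by rewrite (eq_integral (cst 0%E)) ?integral0// => y _; rewrite mulr0.
have : bdd_meas I01 (fun y => D (x, y)).
  by apply: nneg_bdd_meas_bdd_meas; exact: (nneg_bdd_meas_comp nD (pair1_measurable x)).
move=> /(@bdd_meas_integrable _ _ R mu I01 (@measurable_I01 R) (fin_I01 R))
  /integrable_fin_num; move=> /(_ (@measurable_I01 R)) h.
rewrite /Rintegral fineK//= [RHS]integral_mkcond; apply: eq_integral => y _.
by rewrite patchE; case: ifP => _; rewrite ?mulr1 ?mulr0.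
Qed.

(** The order i < j of the coordinates is the order of integration, so a single use of
    Tonelli's theorem suffices, and the other coordinates integrate to 1. *)
Lemma cube_int_pair m (D : R * R -> R) (i j : 'I_m) : nneg_bdd_meas D -> (i < j)%N ->
  cube_int (fun t : m.-tuple R => D (tnth t i, tnth t j)) = \int[mu2]_(z in Sq) D z.
Proof.
move=> nD; elim: m i j => [[]//|m IH] i j /=.
case: (unliftP ord0 j) => [j'|] ->; last by rewrite ltn0.
case: (unliftP ord0 i) => [i'|] -> ij.
  rewrite (@eq_Rintegral _ _ _ mu I01 (cst (\int[mu2]_(z in Sq) D z))).
    exact: Rint_I01_cst.
  move=> x _; rewrite -(IH i' j') //=; apply: eq_cube_int => t _.
  by rewrite !tnthS.
rewrite Rint_square//; apply: eq_Rintegral => x _.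
rewrite -(cube_int_coord (fun y => D (x, y)) j').
by apply: eq_cube_int => t _; rewrite tnth0 tnthS.
Qed.

Lemma cube_int_cell m n (F : m.-tuple 'I_n.+1 -> R) :
  cube_int (fun t : m.-tuple R => F [tuple of map (@cell R n) t]) = tuple_avg F.
Proof.
elim: m F => [|m IH] F /=; first by congr F; apply: val_inj.
rewrite (@eq_Rintegral _ _ _ mu I01 (fun x => tuple_avg (fun t => F [tuple of cell n x
  :: t]))).
  by rewrite (Rint_cell (fun a => tuple_avg (fun t => F [tuple of a :: t]))) card_ord.
move=> x _; rewrite -IH; apply: eq_cube_int => t _.
by congr F; apply: val_inj.
Qed.

End cube_integral.

(** * From graphons to graphs on the cells *)

Section graphon_extension.
Variable R : realType.
Local Notation mu := (@lebesgue_measure R).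
Local Notation mu2 := (mu \x mu)%E.
Local Notation I01 := (`[0%R, 1%R]%classic : set R).
Local Notation Sq := (I01 `*` I01).

Variable f : graphon R.

Definition graphon_ext : R * R -> R := f \_ Sq.

Lemma graphon_extE z : Sq z -> graphon_ext z = f z.
Proof. by move=> Iz; rewrite /graphon_ext patchE mem_set. Qed.

Lemma graphon_ext_itv z : 0 <= graphon_ext z <= 1.
Proof.
rewrite /graphon_ext patchE; case: ifPn => [/set_mem|_]; last by rewrite lexx ler01.
by case: z => x y [/= Ix Iy]; exact: graphon_itv.
Qed.

Lemma nneg_bdd_meas_ext : nneg_bdd_meas graphon_ext.
Proof.
split; last by exists 1 => z; case/andP: (graphon_ext_itv z).
  by apply/(measurable_restrictT _ (@measurable_sq R)); exact: graphon_meas.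
by move=> z; case/andP: (graphon_ext_itv z).
Qed.

Definition superlevel (eta : R) : set (R * R) := [set z | eta <= graphon_ext z].

Lemma measurable_superlevel eta : measurable (superlevel eta).
Proof.
have [mf _ _] := nneg_bdd_meas_ext.
rewrite (_ : superlevel eta = graphon_ext @^-1` `[eta, +oo[).
  by rewrite -[X in measurable X]setTI; apply: mf.
by apply/seteqP; split => z; rewrite /superlevel /= in_itv /= andbT.
Qed.

Lemma superlevel_sym eta z : superlevel eta z -> superlevel eta (z.2, z.1).
Proof.
case: z => x y; rewrite /superlevel /graphon_ext /= !patchE !in_setX /= andbC.
by case: ifP => // /andP[/set_mem Iy /set_mem Ix]; rewrite graphon_sym.
Qed.

End graphon_extension.

Section hom_bound.
Local Notation mu := lebesgue_measure.
Variables (R : realType) (m k n : nat) (H : sgraph m) (f : graphon R).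
Variables (col : 'I_m -> 'I_k.+2) (col_proper : forall i j, H i j -> col i != col j).
Variables (eta : R) (eta0 : 0 < eta) (G : rel 'I_n.+1).

Definition edge_count : nat := #|[pred e : 'I_m * 'I_m | (e.1 < e.2)%N && H e.1 e.2]|.

(** If a tuple of cells is a homomorphism into G, then at any point of these cells
    either all the edges of H fall in {f >= eta}, and the product of the values of f is
    at least eta^e(H), or some edge falls in the symmetric difference of {f >= eta} and
    the grid set of G.  Integrating this over the cube bounds the density of
    homomorphisms into G, which itself is at least a power of the density of cliques. *)
Lemma clique_density_le_hom : eta <= 1 ->
  map_density R (clique_maps G k.+2 [set: 'I_n.+1]%SET) ^+ (2 ^ m) <=
  (eta ^+ edge_count)^-1 * hom_density H f
  + edge_count%:R * area (superlevel f eta `+` gridset G).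
Proof.
move=> eta1.
pose E (e : 'I_m * 'I_m) := (e.1 < e.2)%N && H e.1 e.2.
pose F (t : m.-tuple 'I_n.+1) : R := [forall e : 'I_m * 'I_m, E e ==> G (tnth t e.1)
  (tnth t e.2)]%:R.
pose cs : m.-tuple 'I_k.+2 := [tuple col i | i < m].
have le1 : map_density R (clique_maps G k.+2 [set: 'I_n.+1]%SET) ^+ (2 ^ m) <= tuple_avg F.
  apply: (@tuple_avg_survivors _ _ R _ _ _ cs); first by rewrite card_ord.
    by move=> t; exact: ler0n.
  move=> t tS; rewrite /F ler1n lt0b; apply/forallP => -[i j];
    apply/implyP => /andP[/= ij Hij].
  by apply: (survivors_adjacent tS ij); rewrite !tnth_mktuple; exact: col_proper.
apply: le_trans le1 _; rewrite -cube_int_cell.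
pose D (z : R * R) : R := (z \in superlevel f eta `+` gridset G)%:R.
have mUG : measurable (superlevel f eta `+` gridset G).
  by apply: measurable_setY; [exact: measurable_superlevel|exact: measurable_gridset].
have nD : nneg_bdd_meas D by apply: nneg_bdd_meas_bool; rewrite set_mem_set.
have nP : nneg_bdd_meas (fun t : m.-tuple R => \prod_(e : 'I_m * 'I_m | E e)
  graphon_ext f (tnth t e.1, tnth t e.2)).
  by apply: nneg_bdd_meas_prod => e; apply: nneg_bdd_meas_coords; exact: nneg_bdd_meas_ext.
have nS : nneg_bdd_meas (fun t : m.-tuple R => \sum_(e : 'I_m * 'I_m | E e) D (tnth t
  e.1, tnth t e.2)).
  by apply: nneg_bdd_meas_sum => e; exact: nneg_bdd_meas_coords.
have e0 : 0 < eta ^+ edge_count by rewrite exprn_gt0.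
have nP' : nneg_bdd_meas (fun t : m.-tuple R => (eta ^+ edge_count)^-1 * \prod_(e :
  'I_m * 'I_m | E e) graphon_ext f (tnth t e.1, tnth t e.2)).
  by apply: nneg_bdd_measM => //; apply: nneg_bdd_meas_cst; rewrite invr_ge0 ltW.
have nF : nneg_bdd_meas (fun t : m.-tuple R => F [tuple of map (@cell R n) t]).
  apply: nneg_bdd_meas_bool.
  rewrite (_ : [set _ | _] = \bigcap_(e in [set e : 'I_m * 'I_m | E e])
      ((fun t : m.-tuple R => (tnth t e.1, tnth t e.2)) @^-1` gridset G)).
    apply: fin_bigcap_measurable => [|e _]; first exact: finite_finset.
    rewrite -[X in measurable X]setTI.
    have : measurable_fun setT (fun t : m.-tuple R => (tnth t e.1, tnth t e.2)).
      by apply: measurable_fun_pair; exact: measurable_tnth.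
    by apply => //; exact: measurable_gridset.
  apply/seteqP; split => t /=.
    move=> /forallP h e Ee; have := h e; rewrite !tnth_map.
    by move=> /implyP; apply.
  move=> h; apply/forallP => e; apply/implyP => Ee.
  by rewrite !tnth_map; exact: h.
have hE : hom_density H f = cube_int (fun t : m.-tuple R => \prod_(e : 'I_m * 'I_m | E
  e) graphon_ext f (tnth t e.1, tnth t e.2)).
  apply: eq_cube_int => t It; apply: eq_bigr => e _; rewrite graphon_extE//.
  by split; exact: It.
have aE : edge_count%:R * area (superlevel f eta `+` gridset G) =
    cube_int (fun t : m.-tuple R => \sum_(e : 'I_m * 'I_m | E e) D (tnth t e.1, tnth t
      e.2)).
  rewrite cube_int_sum; last by move=> e; exact: nneg_bdd_meas_coords.
  rewrite mulr_natl /edge_count -sumr_const; apply: eq_big => // e /andP[ij _].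
  rewrite cube_int_pair//; symmetry.
  have := @Rint_bool _ _ R (mu \x mu)%E _ (@measurable_sq R) (fun z => z \in superlevel
    f eta `+` gridset G).
  by rewrite set_mem_set; exact.
rewrite hE aE -cube_intZ// -cube_intD//; apply: le_cube_int => //;
  first exact: nneg_bdd_measD.
move=> t _; rewrite /F; case: forallP => [h|_] /=; last first.
  rewrite addr_ge0//.
    by have [_ + _] := nP'; apply.
  by have [_ + _] := nS; apply.
have [allU|/existsP[e]] := boolP [forall e : 'I_m * 'I_m, E e ==> (eta <= graphon_ext f
  (tnth t e.1, tnth t e.2))].
  rewrite -[leLHS]addr0; apply: lerD; last by have [_ + _] := nS; apply.
  rewrite ler_pdivlMl// mulr1 /edge_count -prodr_const.
  apply: ler_prod => e Ee; rewrite (ltW eta0) /=.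
  by have /forallP/(_ e) := allU; rewrite /E; move: Ee; rewrite inE => ->.
rewrite negb_imply => /andP[Ee nU].
rewrite -[leLHS]add0r; apply: lerD; first by have [_ + _] := nP'; apply.
rewrite (bigD1 e)//= (_ : D _ = 1).
  by rewrite lerDl; apply: sumr_ge0 => e' _; have [_ + _] := nD; apply.
rewrite /D mem_set//; right; split; last by apply/negP.
by have := h e; rewrite Ee !tnth_map.
Qed.

End hom_bound.

(** * Permutations of cells as measure-preserving bijections *)

Section permuting_cells.
Variables (R : realType) (n : nat).

Local Notation mu := (@lebesgue_measure R).
Local Notation I01 := (`[0%R, 1%R]%classic : set R).
Implicit Types (s : {perm 'I_n.+1}) (a : 'I_n.+1) (x : R) (A : set R).
Local Notation cell := (@cell R n).

Lemma lebesgue_measureD (c : R) A : measurable A -> mu [set x | A (x + c)] = mu A.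
Proof.
move=> mA; pose sh (x : R) : R := x + c.
have msh : measurable_fun [set: R] sh by apply: measurable_funD.
pose m' : {measure set (measurableTypeR R) -> \bar R} :=
  measure_function_pushforward__canonical__measure_function_Measure mu
    (msh : measurable_fun setT (sh : measurableTypeR R -> measurableTypeR R)).
have := @lebesgue_measure_unique R m' _ A mA; move=> ->; first by [].
move=> _ [[u v] _ <-]; rewrite /m' /= /pushforward.
rewrite (_ : sh @^-1` _ = `]u - c, v - c]%classic); last first.
  by apply/seteqP; split => x; rewrite /= !in_itv /= ltrBlDr lerBrDr.
by rewrite !lebesgue_measure_itv /= !lte_fin ltrD2r -!EFinB; congr (if _ then _ else _);
  congr EFin; lra.
Qed.

Definition cell_shift s a : R := ((s a)%:R - a%:R) / n.+1%:R.

Definition permute_cells s x : R := if 0 <= x < 1 then x + cell_shift s (cell x) else x.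

Let N0 : 0 < n.+1%:R :> R. Proof. by rewrite ltr0n. Qed.

Lemma shift_itv s a x : a%:R / n.+1%:R <= x < a.+1%:R / n.+1%:R ->
  (s a)%:R / n.+1%:R <= x + cell_shift s a < (s a).+1%:R / n.+1%:R.
Proof.
rewrite /cell_shift mulrBl -!natr1 !mulrDl; set i := _^-1.
set u := _ * i; set v := _ * i; lra.
Qed.

Lemma permute_cells_cell s x : 0 <= x < 1 ->
  cell (permute_cells s x) = s (cell x) /\ 0 <= permute_cells s x < 1.
Proof.
move=> x01; have h := shift_itv s (cell_itv n x01).
by rewrite /permute_cells x01; split; [exact: cell_eq|exact: ord_itv h].
Qed.

Lemma permute_cellsK s x : permute_cells s^-1%g (permute_cells s x) = x.
Proof.
have [x01|x01] := boolP (0 <= x < 1).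
  have [e h] := permute_cells_cell s x01.
  rewrite {1}/permute_cells h e /permute_cells x01 /cell_shift permK.
  by rewrite -addrA -mulrDl addrA subrK subrr mul0r addr0.
by rewrite /permute_cells !(negbTE x01).
Qed.

Lemma permute_cellsVK s x : permute_cells s (permute_cells s^-1%g x) = x.
Proof. by rewrite -{1}[s]invgK permute_cellsK. Qed.

Lemma permute_cells_I01 s x : I01 x -> I01 (permute_cells s x).
Proof.
have [x01 _|x01] := boolP (0 <= x < 1).
  have [_ /andP[h0 h1]] := permute_cells_cell s x01.
  by rewrite /= in_itv /= h0 ltW.
by rewrite /permute_cells (negbTE x01).
Qed.

Lemma measurable_permute_cells s : measurable_fun [set: R] (permute_cells s).
Proof.
apply: measurable_fun_ifT => //; last first.
  apply: measurable_funD => //.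
  have [] := @bdd_meas_step _ _ R setT _ cell (cell_shift s) (@measurable_cell R n).
  by [].
apply: (measurable_fun_bool true); rewrite setTI (_ : _ @^-1` _ = `[0, 1[%classic).
  exact: measurable_itv.
by apply/seteqP; split => x /=; rewrite in_itv.
Qed.

Definition cell_itvset a : set R := `[a%:R / n.+1%:R, a.+1%:R / n.+1%:R[%classic.

Lemma mu_split_cells A : measurable A -> A `<=` I01 ->
  mu A = (mu ([set 1%R] `&` A) + \sum_(a < n.+1) mu (cell_itvset a `&` A))%E.
Proof.
move=> mA AI.
have mJ a : measurable (cell_itvset a `&` A).
  by apply: measurableI => //; exact: measurable_itv.
have mU : measurable (\big[setU/set0]_(a < n.+1) (cell_itvset a `&` A)).
  exact: bigsetU_measurable.
have m1 : measurable ([set 1] `&` A) by apply: measurableI.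
rewrite -(@measure_semi_additive_ord _ _ _ mu) //; last first.
  move=> a b _ _ [x [[+ _] [+ _]]]; rewrite /cell_itvset /= !in_itv /= => ha hb.
  by rewrite -(cell_eq ha) (cell_eq hb).
have -> : (mu ([set 1%R] `&` A) + mu (\big[setU/set0]_(a < n.+1) (cell_itvset a `&` A)) =
    mu (([set 1%R] `&` A) `|` \big[setU/set0]_(a < n.+1) (cell_itvset a `&` A)))%E.
  symmetry; apply: measureU => //.
  apply/seteqP; split => // x [[/= -> _]]; rewrite -bigcup_mkord_ord => -[k /= kn].
  rewrite /cell_itvset /= in_itv /= => -[/ord_itv /andP[_]].
  by rewrite ltxx.
congr (mu _); apply/seteqP; split => x.
  move=> Ax; have := AI _ Ax; rewrite /= in_itv /= => /andP[x0].
  rewrite le_eqVlt => /predU1P[x1|x1]; first by left.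
  right; rewrite -bigcup_mkord_ord; exists (cell x : nat); first exact: ltn_ord.
  by split=> //; rewrite inord_val /cell_itvset /= in_itv /=; apply: cell_itv; rewrite x0.
case=> [[_ //]|]; rewrite -bigcup_mkord_ord => -[k _ [_ //]].
Qed.

Lemma permute_cells_pres s A : measurable A -> A `<=` I01 ->
  mu (I01 `&` permute_cells s @^-1` A) = mu A.
Proof.
move=> mA AI; rewrite mu_split_cells; last 2 first.
- apply: measurableI; first exact: measurable_itv.
  by rewrite -[X in measurable X]setTI; apply: measurable_permute_cells.
- exact: subIsetl.
rewrite [RHS]mu_split_cells//; congr (_ + _)%E.
  congr (mu _); apply/seteqP; split => x /=.
    by move=> [-> [_]]; rewrite /permute_cells ltxx andbF.
  by move=> [-> ?]; rewrite in_itv /= ler01 lexx /permute_cells ltxx andbF.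
rewrite [RHS](reindex_inj (@perm_inj _ s)) /=; apply: eq_bigr => a _.
rewrite -[RHS](lebesgue_measureD (cell_shift s a)); last first.
  by apply: measurableI => //; exact: measurable_itv.
congr (mu _); apply/seteqP; split => x /=; rewrite /cell_itvset /= !in_itv /=.
  move=> [ha [_]]; rewrite /permute_cells (ord_itv ha) (cell_eq ha).
  by split=> //; exact: shift_itv.
move=> [hs xA].
have ha : a%:R / n.+1%:R <= x < a.+1%:R / n.+1%:R.
  move: hs; rewrite /cell_shift mulrBl -!natr1 !mulrDl; set i := _^-1.
  set u := _ * i; set v := _ * i; lra.
have /andP[x0 x1] := ord_itv ha.
by split=> //; rewrite x0 (ltW x1) /permute_cells (ord_itv ha) (cell_eq ha).
Qed.

Definition perm_mpbij s : mpbij R.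
Proof.
apply: (@MPBij R (permute_cells s)).
- split.
  + by move=> x; exact: permute_cells_I01.
  + by move=> x y _ _ e; rewrite -(permute_cellsK s x) e permute_cellsK.
  + by move=> y Iy; exists (permute_cells s^-1%g y);
    [exact: permute_cells_I01|exact: permute_cellsVK].
- by apply: measurable_funTS; exact: measurable_permute_cells.
- move=> A mA AI; rewrite (_ : _ @` A = permute_cells s^-1%g @^-1` A).
    by rewrite -[X in measurable X]setTI; apply: measurable_permute_cells.
  apply/seteqP; split => [_ [x Ax <-]|x Ax] /=; first by rewrite permute_cellsK.
  by exists (permute_cells s^-1%g x) => //; exact: permute_cellsVK.
- by move=> A mA AI; exact: permute_cells_pres.
Defined.

End permuting_cells.

(** * Energy of a graphon *)

Section energy.
Variable R : realType.
Local Notation mu := (@lebesgue_measure R).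
Local Notation mu2 := (mu \x mu)%E.
Local Notation I01 := (`[0%R, 1%R]%classic : set R).
Local Notation Sq := (I01 `*` I01).
Implicit Types (f : graphon R) (beta : R).

Lemma graphon_sq f z : Sq z -> 0 <= f z <= 1.
Proof. by case: z => x y [/= Ix Iy]; exact: graphon_itv. Qed.

Lemma bdd_meas_graphon f : bdd_meas Sq f.
Proof.
split; first exact: graphon_meas.
by exists 1 => z /(graphon_sq f) /andP[f0 f1]; rewrite ger0_norm.
Qed.

Lemma measurable_Ient : measurable_fun [set: R] (@Ient R).
Proof.
have m1 : measurable_fun [set: R] (fun u : R => 1 - u) by apply: measurable_funB.
apply: measurable_funD; apply: measurable_funM.
- exact: measurable_funM.
- exact: measurable_ln.
- exact: measurable_funM.
- exact: measurableT_comp (@measurable_ln R) m1.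
Qed.

(** Up to sign, the entropy is the tilted entropy at beta = 0. *)
Lemma Ient_bound (u : R) : 0 <= u <= 1 -> `|Ient u| <= 2.
Proof.
move=> u01; have /andP[u0 u1] := u01.
have I0 : Ient u <= 0.
  have h1 : u * ln u <= 0 by rewrite mulr_ge0_le0// ln_le0.
  have h2 : (1 - u) * ln (1 - u) <= 0.
    by rewrite mulr_ge0_le0 ?subr_ge0// ln_le0// gerBl.
  by rewrite /Ient; lra.
have := tilt_le_sqrt 0 u01; rewrite /tilt normr0 addr0 mul0r add0r => h.
have : Num.sqrt u <= 1 by rewrite -sqrtr1 ler_wsqrtr.
by rewrite ler0_norm//; lra.
Qed.

Lemma bdd_meas_Ient f : bdd_meas Sq (fun z => Ient (f z)).
Proof.
split; first exact: measurableT_comp measurable_Ient (graphon_meas f).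
by exists 2 => z /(graphon_sq f); exact: Ient_bound.
Qed.

Definition energy beta f : R := \int[mu2]_(z in Sq) tilt beta (f z).

Lemma bdd_meas_tilt beta f : bdd_meas Sq (fun z => tilt beta (f z)).
Proof. by apply: bdd_measB; [apply: bdd_measZ; exact: bdd_meas_graphon|exact:
  bdd_meas_Ient]. Qed.

Local Notation Rle := (@Rint_le _ _ R mu2 Sq (@measurable_sq R) (fin_Sq R)).
Local Notation RD := (@RintD _ _ R mu2 Sq (@measurable_sq R) (fin_Sq R)).
Local Notation RZ := (@RintZ _ _ R mu2 Sq (@measurable_sq R) (fin_Sq R)).

Lemma Rint_Sq_cst c : \int[mu2]_(_ in Sq) c = c.
Proof.
transitivity (c * fine (mu2 Sq)); last by rewrite mu2_Sq mulr1.
exact: (Rintegral_cst mu2 (@measurable_sq R)).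
Qed.

Lemma Tfun_sub_Ifun m (H : sgraph m) beta beta2 f :
  Tfun H beta beta2 f - Ifun f = energy beta f + beta2 * hom_density H f.
Proof.
have -> : energy beta f = beta * \int[mu2]_(z in Sq) f z - Ifun f.
  rewrite /energy -RZ; last exact: bdd_meas_graphon.
  rewrite -[Ifun f]mul1r -mulNr -RZ; last exact: bdd_meas_Ient.
  rewrite -RD; [|by apply: bdd_measZ; exact: bdd_meas_graphon|by apply: bdd_measZ;
    exact: bdd_meas_Ient].
  by apply: eq_Rintegral => z _; rewrite /tilt mulN1r.
by rewrite /Tfun; lra.
Qed.

Lemma area_bool (b : R * R -> bool) : measurable [set z | b z] ->
  area [set z | b z] = \int[mu2]_(z in Sq) (b z)%:R.
Proof. by move=> mb; have := @Rint_bool _ _ R mu2 _ (@measurable_sq R) b mb => ->. Qed.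

Lemma area_set (A : set (R * R)) : measurable A ->
  area A = \int[mu2]_(z in Sq) (z \in A)%:R.
Proof.
by move=> mA; rewrite -{1}[A]set_mem_set area_bool ?set_mem_set.
Qed.

Lemma energy_le_tilt_max beta f : energy beta f <= tilt_max beta.
Proof.
rewrite -[leRHS]Rint_Sq_cst; apply: Rle; [exact: bdd_meas_tilt|exact: bdd_meas_cst|].
move=> z /(graphon_sq f) /(tilt_le beta) h; apply: le_trans h _.
by rewrite gerBl mulr_ge0// sqr_ge0.
Qed.

Lemma bdd_meas_superlevel f eta : bdd_meas Sq (fun z => (eta <= graphon_ext f z)%R%:R : R).
Proof. by apply: bdd_meas_bool; exact: measurable_superlevel. Qed.

Let p beta := edge_prob beta.

Lemma bdd_meas_sqdev beta f eta :
  bdd_meas Sq (fun z => (eta <= graphon_ext f z)%R%:R * (f z - p beta) ^+ 2).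
Proof.
apply: bdd_measM; first exact: bdd_meas_superlevel.
have b : bdd_meas Sq (fun z => f z - p beta) by apply: bdd_measB;
  [exact: bdd_meas_graphon|exact: bdd_meas_cst].
exact: (bdd_measM b b).
Qed.

(** On {f >= eta} this is the quadratic gap of [tilt_le], and elsewhere the tilted
    entropy is small because f is. *)
Lemma energy_deviation beta f eta : 0 <= eta ->
  energy beta f + 8^-1 * \int[mu2]_(z in Sq) ((eta <= graphon_ext f z)%R%:R * (f z - p
    beta) ^+ 2)
  <= tilt_max beta * area (superlevel f eta) + (2 + `|beta|) * Num.sqrt eta.
Proof.
move=> eta0.
have bd := bdd_meas_sqdev beta f eta; have bu := bdd_meas_superlevel f eta.
rewrite (area_bool (b := fun z => eta <= graphon_ext f z));
  last exact: measurable_superlevel.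
rewrite -RZ// -RZ// -[_ * Num.sqrt eta]Rint_Sq_cst.
rewrite -RD; [|exact: bdd_meas_tilt|exact: bdd_measZ].
rewrite -RD; [|exact: bdd_measZ|exact: bdd_meas_cst].
apply: Rle.
- by apply: bdd_measD; [exact: bdd_meas_tilt|exact: bdd_measZ].
- by apply: bdd_measD; [exact: bdd_measZ|exact: bdd_meas_cst].
move=> z Sz; rewrite graphon_extE//; have f01 := graphon_sq f Sz.
case: (leP eta (f z)) => [_|lt_eta] /=.
  rewrite !mulr1n mulr1 mul1r; apply: le_trans (_ : tilt_max beta <= _).
    by have := tilt_le beta f01; rewrite -/(p beta); lra.
  by rewrite lerDl mulr_ge0 ?sqrtr_ge0// addr_ge0.
rewrite !mulr0n mul0r !mulr0 addr0 add0r; apply: le_trans (tilt_le_sqrt beta f01) _.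
by apply: ler_wpM2l; [rewrite addr_ge0|apply: ler_wsqrtr; exact: ltW].
Qed.

Lemma area_gridset n (G : rel 'I_n.+1) :
  area (gridset (R := R) G) = (n.+1%:R ^+ 2)^-1 * pair_count R G.
Proof.
rewrite (area_bool (b := fun z => G (cell n z.1) (cell n z.2)));
  last exact: measurable_gridset.
exact: (Rint_cell2 (fun a b => (G a b)%:R)).
Qed.

(** An approximation of a symmetric set may be asymmetric, but its symmetrization is
    wrong only where it or its reflection is. *)
Lemma symmetrize_grid n (G : rel 'I_n.+1) (U : set (R * R)) : measurable U ->
  (forall z, U z -> U (z.2, z.1)) ->
  area (U `+` gridset (fun a b => G a b && G b a)) <= 2 * area (U `+` gridset G).
Proof.
move=> mU Usym; have mG K : measurable (gridset (R := R) (n := n) K) by exact: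
  measurable_gridset.
have mX K : measurable (U `+` gridset (n := n) K) by apply: measurableU; apply: measurableD.
have swap2 z : U (z.2, z.1) -> U z by case: z => x y /Usym.
rewrite mulr_natl mulr2n -[X in _ <= X + _]area_swap//; apply: area_le2 => //.
  rewrite (_ : [set _ | _] = (fun z => (z.2, z.1)) @^-1` (U `+` gridset G))//.
  have : measurable_fun [set: R * R] (fun z : R * R => (z.2, z.1)).
    by apply: measurable_fun_pair.
  by move=> msw; rewrite -[X in measurable X]setTI; apply: msw.
move=> z; rewrite /gridset /setY /setU /setD /=.
case=> [[Uz /negP]|[/andP[G1 G2] nU]]; last by right; right.
rewrite negb_and => /orP[] /negP nG; first by right; left.
by left; left; split=> //; exact: Usym.
Qed.

Lemma turan_block n k M x y : n.+1 = (k.+1 * M)%N -> 0 <= x < 1 -> 0 <= y < 1 ->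
  turan_fun k.+2%:R (x, y) = (block k M (cell n x) != block k M (cell n y))%:R :> R.
Proof.
move=> nE x01 y01.
have M0 : (0 < M)%N by move: nE; case: M => //; rewrite muln0.
have fl (z : R) : 0 <= z < 1 -> Num.floor ((k.+2%:R - 1) * z) = (block k M (cell n z) :
  nat)%:Z.
  move=> z01; have /andP[h1 h2] := cell_itv n z01.
  rewrite (blockE nE); set c := cell n z in h1 h2 *.
  have r0 : 0 < k.+1%:R :> R by rewrite ltr0n.
  have MM0 : 0 < M%:R :> R by rewrite ltr0n.
  rewrite (_ : k.+2%:R - 1 = k.+1%:R); last by rewrite -[k.+2%:R]natr1 addrK.
  have NE : n.+1%:R = k.+1%:R * M%:R :> R by rewrite nE natrM.
  move: h1 h2; rewrite NE invfM mulrCA => h1; rewrite mulrCA => h2.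
  apply: floor_def; apply/andP; split.
    rewrite mulrC -ler_pdivrMr// mulrC; apply: le_trans h1.
    rewrite ler_pM2l ?invr_gt0// ler_pdivlMr// -[(_ %/ _)%N%:~R]/((_ %/ _)%N%:R).
    by rewrite -natrM ler_nat leq_trunc_div.
  rewrite mulrC -ltr_pdivlMr// mulrC; apply: lt_le_trans h2 _.
  rewrite ler_pM2l ?invr_gt0// ler_pdivrMr// -(PoszD _ 1) -[(_ + 1)%N%:~R]/((_ + 1)%N%:R).
  by rewrite -natrM ler_nat addn1 ltn_ceil.
by rewrite /turan_fun /= !fl// eqz_nat val_eqE; case: (_ == _).
Qed.

End energy.

(** * Distance to the Turan graphon *)

Section distance.
Variable R : realType.
Local Notation mu := (@lebesgue_measure R).
Local Notation mu2 := (mu \x mu)%E.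
Local Notation I01 := (`[0%R, 1%R]%classic : set R).
Local Notation Sq := (I01 `*` I01).
Implicit Types (f g : graphon R) (beta : R).
Local Notation Rle := (@Rint_le _ _ R mu2 Sq (@measurable_sq R) (fin_Sq R)).
Local Notation RD := (@RintD _ _ R mu2 Sq (@measurable_sq R) (fin_Sq R)).
Local Notation RZ := (@RintZ _ _ R mu2 Sq (@measurable_sq R) (fin_Sq R)).

Lemma cut_dist_le_L1 f g : cut_dist f g <= \int[mu2]_(z in Sq) `|f z - g z|.
Proof.
have bfg : bdd_meas Sq (fun z => f z - g z) by apply: bdd_measB; exact: bdd_meas_graphon.
apply: cut_dist_le => S A mS mA SI AI.
have mSA : measurable (S `*` A) by exact: measurableX.
have SASq : S `*` A `<=` Sq by move=> [x y] [/SI ? /AI ?].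
have fSA : (mu2 (S `*` A) < +oo)%E.
  by apply: le_lt_trans (fin_Sq R); apply: le_measure; rewrite ?inE//; exact: measurable_sq.
have bSA : bdd_meas (S `*` A) (fun z => f z - g z).
  case: bfg => mfg [K fgK]; split; last by exists K => z /SASq; exact: fgK.
  by apply: measurable_funS mfg => //; exact: measurable_sq.
apply: le_trans (le_normr_Rintegral _ _) _; first exact: mSA.
  exact: (@bdd_meas_integrable _ _ R mu2 _ mSA fSA _ bSA).
rewrite /Rintegral; apply: fine_le.
- apply: integrable_fin_num => //.
  exact: (@bdd_meas_integrable _ _ R mu2 _ mSA fSA _ (bdd_meas_norm bSA)).
- apply: integrable_fin_num; first exact: measurable_sq.
  exact: (@bdd_meas_integrable _ _ R mu2 _ (@measurable_sq R) (fin_Sq R) _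
    (bdd_meas_norm bfg)).
- apply: ge0_subset_integral => //=; first exact: measurable_sq.
  by apply/measurable_EFinP; have [] := bdd_meas_norm bfg.
Qed.

Lemma Rint_line1 : \int[mu2]_(z in Sq) (1 <= z.1 <= 1)%R%:R = 0 :> R
  /\ \int[mu2]_(z in Sq) (1 <= z.2 <= 1)%R%:R = 0 :> R.
Proof.
have [h1 h2] := area_strip (lexx (1 : R)); rewrite subrr in h1 h2.
have [m1 m2] := measurable_strip (1 : R) 1.
split.
  by rewrite -(area_bool (b := fun z => 1 <= z.1 <= 1))//; apply/eqP;
    rewrite eq_le h1 area_ge0.
by rewrite -(area_bool (b := fun z => 1 <= z.2 <= 1))//; apply/eqP;
  rewrite eq_le h2 area_ge0.
Qed.

(** The L^1 distance is split along f, p 1_U, p 1_G and p times the rearranged Turan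
    function, with U = {f >= eta}.  On U, |f - p| is at most al + (f - p)^2 / al. *)
Lemma cut_dist_turan beta f (eta al : R) k n M (nE : n.+1 = (k.+1 * M)%N)
    (G : rel 'I_n.+1) (s : {perm 'I_n.+1}) : 0 <= eta -> 0 < al ->
  cut_dist f (gact (gscale (edge_prob_itv beta) (turan k.+2%:R)) (perm_mpbij R s)) <=
  al + al^-1 * \int[mu2]_(z in Sq) ((eta <= graphon_ext f z)%R%:R * (f z - edge_prob
    beta) ^+ 2)
  + eta + area (superlevel f eta `+` gridset G)
  + (n.+1%:R ^+ 2)^-1 * pair_count R (fun a b => G a b != (block k M (s a) != block k M
    (s b))).
Proof.
move=> eta0 al0; apply: le_trans (cut_dist_le_L1 _ _) _.
set p := edge_prob beta; set g' := gact _ _.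
set W := fun a b => G a b != _.
have mUG : measurable (superlevel f eta `+` gridset G).
  by apply: measurable_setY; [exact: measurable_superlevel|exact: measurable_gridset].
have bD : bdd_meas Sq (fun z => (z \in superlevel f eta `+` gridset G)%:R : R).
  by apply: bdd_meas_bool; rewrite set_mem_set.
have bW : bdd_meas Sq (fun z => (W (cell n z.1) (cell n z.2))%:R : R).
  exact: (@bdd_meas_step _ _ _ _ _ (@cell2 R n) (fun c => (W c.1 c.2)%:R)
    (@measurable_cell2 R n)).
have b1 : bdd_meas Sq (fun z => (1 <= z.1 <= 1)%R%:R : R).
  by apply: bdd_meas_bool; have [] := measurable_strip (1 : R) 1.
have b2 : bdd_meas Sq (fun z => (1 <= z.2 <= 1)%R%:R : R).
  by apply: bdd_meas_bool; have [] := measurable_strip (1 : R) 1.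
have bS := bdd_meas_sqdev beta f eta.
have bZ := bdd_measZ al^-1 bS.
have [i1 i2] := Rint_line1.
have ba : bdd_meas Sq (fun _ : R * R => al) by exact: bdd_meas_cst.
have be : bdd_meas Sq (fun _ : R * R => eta) by exact: bdd_meas_cst.
have c1 := bdd_measD ba bZ; have c2 := bdd_measD c1 be; have c3 := bdd_measD c2 bD.
have c4 := bdd_measD c3 bW; have c5 := bdd_measD c4 b1; have c6 := bdd_measD c5 b2.
have := RD c5 b2; rewrite (RD c4 b1) (RD c3 bW) (RD c2 bD) (RD c1 be) (RD ba bZ) (RZ
  al^-1 bS).
rewrite !Rint_Sq_cst i1 i2 !addr0 -area_set// (Rint_cell2 (fun a b => (W a b)%:R)) => <-.
apply: Rle => //.
  by apply: bdd_meas_norm; apply: bdd_measB; exact: bdd_meas_graphon.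
move=> z Sz; have f01 := graphon_sq f Sz; have /andP[f0 f1] := f01.
have /andP[p0 p1] : 0 <= p <= 1 by exact: edge_prob_itv.
have gz : g' z = p * turan_fun k.+2%:R (permute_cells s z.1, permute_cells s z.2) by [].
set h := turan_fun _ _ in gz.
have h01 : 0 <= h <= 1 by rewrite /h /turan_fun; case: ifP; rewrite ?lexx ?ler01.
have D0 (b : bool) : 0 <= b%:R :> R by exact: ler0n.
rewrite -(graphon_extE f Sz) in f0 f1 *.
set u := graphon_ext f z in f0 f1 *.
have q0 : 0 <= al^-1 * (u - p) ^+ 2 by apply: mulr_ge0;
  [rewrite invr_ge0 ltW|exact: sqr_ge0].
have absq : `|u - p| <= al + al^-1 * (u - p) ^+ 2.
  rewrite -lerBlDl -(ler_pM2l al0) mulrA mulfV ?gt_eqF// mul1r -real_normK ?num_real//.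
  set a := `|_|; have := sqr_ge0 (a - al); have := sqr_ge0 a; have := sqr_ge0 al; nra.
have main : `|u - p * (eta <= u)%R%:R| <= al + al^-1 * ((eta <= u)%R%:R * (u - p) ^+ 2)
  + eta.
  case: (leP eta u) => hu.
    by rewrite mulr1n mulr1 mul1r; apply: le_trans absq _; rewrite lerDl.
  rewrite mulr0n mulr0 mul0r mulr0 subr0 ger0_norm//; move: hu al0; lra.
have dG : `|(eta <= u)%R%:R - (G (cell n z.1) (cell n z.2))%:R| <= (z \in superlevel f
  eta `+` gridset G)%:R :> R.
  case: (boolP (z \in _)) => [_|].
    by case: (eta <= u)%R; case: (G _ _);
      rewrite ?subrr ?normr0 ?subr0 ?sub0r ?normrN ?normr1//.
  move=> /negP; rewrite inE => nz.
  suff -> : G (cell n z.1) (cell n z.2) = (eta <= u) by rewrite subrr normr0.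
  apply/idP/idP => [Gz|hu].
    by apply: contrapT => nu; apply: nz; right; split.
  by apply: contrapT => nG; apply: nz; left; split.
(* On the lines x = 1 and y = 1 the Turan function has a colour of its own; they are
   null sets, accounted for by the last two terms. *)
have dh : `|(G (cell n z.1) (cell n z.2))%:R - h| <=
    (W (cell n z.1) (cell n z.2))%:R + (1 <= z.1 <= 1)%R%:R + (1 <= z.2 <= 1)%R%:R.
  have dist_le1 : `|(G (cell n z.1) (cell n z.2))%:R - h| <= 1.
    by case: (G _ _); rewrite /= ler_norml; move: h01; lra.
  have [e1|n1] := eqVneq z.1 1.
    apply: le_trans dist_le1 _; rewrite (_ : 1 <= z.1 <= 1 = true); last by rewrite e1 lexx.
    by rewrite mulr1n -addrA addrCA lerDl addr_ge0.
  have [e2|n2] := eqVneq z.2 1.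
    apply: le_trans dist_le1 _; rewrite (_ : 1 <= z.2 <= 1 = true); last by rewrite e2 lexx.
    by rewrite mulr1n lerDr addr_ge0.
  have z1 : 0 <= z.1 < 1.
    by case: Sz => /= + _; rewrite in_itv /= => /andP[-> ?]; rewrite lt_neqAle n1.
  have z2 : 0 <= z.2 < 1.
    by case: Sz => /= _; rewrite in_itv /= => /andP[-> ?]; rewrite lt_neqAle n2.
  have [c1' r1] := permute_cells_cell s z1; have [c2' r2] := permute_cells_cell s z2.
  apply: le_trans (_ : (W (cell n z.1) (cell n z.2))%:R <= _); last first.
    by rewrite -addrA lerDl addr_ge0.
  rewrite /h (turan_block nE)// c1' c2' /W.
  by case: (G _ _); case: (_ != _); rewrite ?subrr ?normr0 ?subr0 ?sub0r ?normrN ?normr1.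
rewrite gz.
have -> : u - p * h = (u - p * (eta <= u)%R%:R) + p * ((eta <= u)%R%:R - (G (cell n
  z.1) (cell n z.2))%:R)
   + p * ((G (cell n z.1) (cell n z.2))%:R - h) by ring.
apply: le_trans (ler_normD _ _) _; apply: le_trans (lerD (ler_normD _ _) (lexx _)) _.
have pw x w : `|x| <= w -> `|p * x| <= w.
  by move=> xw; apply: le_trans xw; rewrite normrM ger0_norm// ler_piMl.
have := lerD (lerD main (pw _ _ dG)) (pw _ _ dh).
by rewrite !addrA.
Qed.

End distance.

(** * Few homomorphisms force the extremal structure *)

Section main.
Variable R : realType.
Local Notation mu := (@lebesgue_measure R).
Local Notation mu2 := (mu \x mu)%E.
Local Notation I01 := (`[0%R, 1%R]%classic : set R).
Local Notation Sq := (I01 `*` I01).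
Implicit Types (f g : graphon R) (beta : R).

(** With eps = al^2, the errors are chosen as follows: gam makes the term 2 r gam of
    the clique count equal to eps, eta makes the values of f below eta contribute at
    most ell eps to the energy, omega is the density of homomorphisms that would force
    too many cliques, and delta bounds the area of the symmetric difference of U and
    its grid approximation so that this difference uses up half of omega; tau uses up
    the other half.  Every error then is O(eps), or O(eps / al) = O(al) after the two
    uses of |x| <= al + x^2 / al. *)
Lemma few_homs_structure m (H : sgraph m) k (col : 'I_m -> 'I_k.+2) beta (al : R) :
  (forall i j, H i j -> col i != col j) -> 0 < al <= 1 ->
  exists2 tau : R, 0 < tau & forall f, hom_density H f <= tau ->
    energy beta f <= tilt_max beta * (1 - k.+1%:R^-1) + 3 * tilt_max beta * al ^+ 2 /\
    (tilt_max beta * (1 - k.+1%:R^-1) <= energy beta f ->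
     exists s : mpbij R,
       cut_dist f (gact (gscale (edge_prob_itv beta) (turan k.+2%:R)) s)
       <= (2 * k.+1%:R + 24 * tilt_max beta + 18) * al).
Proof.
move=> proper /andP[al0 al1].
set r : R := k.+1%:R; have r0 : 0 < r by rewrite ltr0n.
set l := tilt_max beta; have l0 : 0 < l by exact: tilt_max_gt0.
set eps := al ^+ 2; have eps0 : 0 < eps by rewrite exprn_gt0.
have eps_al : eps <= al by rewrite /eps expr2 ler_piMl// ltW.
set gam := eps / (2 * r); have gam0 : 0 < gam by rewrite divr_gt0// mulr_gt0.
have rgam : 2 * r * gam = eps by rewrite /gam mulrC divfK// gt_eqF// mulr_gt0.
set lb := 2 + `|beta|; have lb0 : 0 < lb by rewrite ltr_pwDl.
set eta := Num.min eps ((l * eps / lb) ^+ 2).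
have b0 : 0 < l * eps / lb by rewrite divr_gt0// mulr_gt0.
have eta0 : 0 < eta by rewrite lt_min eps0 exprn_gt0.
have eta_eps : eta <= eps by rewrite ge_min lexx.
have kappa : lb * Num.sqrt eta <= l * eps.
  rewrite mulrC -ler_pdivlMr// -[leRHS]ger0_norm ?(ltW b0)// -sqrtr_sqr.
  by apply: ler_wsqrtr; rewrite ge_min lexx orbT.
set omega := ((gam / 2) ^+ k.+2) ^+ (2 ^ m).
have g20 : 0 < (gam / 2) ^+ k.+2 by rewrite exprn_gt0// divr_gt0.
have omega0 : 0 < omega by rewrite exprn_gt0.
set c : R := (edge_count H)%:R; have c0 : 0 <= c by rewrite ler0n.
set delta := Num.min eps (omega / (2 * (c + 1))).
have delta0 : 0 < delta by rewrite lt_min eps0 divr_gt0// mulr_gt0// ltr_wpDl.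
have delta_eps : delta <= eps by rewrite ge_min lexx.
have cdelta : c * delta <= omega / 2.
  apply: le_trans (_ : (c + 1) * (omega / (2 * (c + 1))) <= _).
    apply: ler_pM => //; first exact: ltW.
      by rewrite lerDl.
    by rewrite ge_min lexx orbT.
  by rewrite le_eqVlt; apply/orP; left; apply/eqP; field; rewrite gt_eqF// ltr_wpDl.
exists (eta ^+ edge_count H * (omega / 2)).
  by rewrite mulr_gt0 ?exprn_gt0// divr_gt0.
move=> f tf; set U := superlevel f eta.
have mU : measurable U by exact: measurable_superlevel.
have d20 : 0 < delta / 2 by rewrite divr_gt0.
have [n0 gridU] := measurable_grid_approx mU d20.
(* The number k.+1 * M of cells is a multiple of r, fine enough for the approximation
   of U, and such that gam times it is at least 2. *)
pose M := (n0 + Num.bound (2 / gam)).+1; pose n := (k.+1 * M).-1.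
have nE : n.+1 = (k.+1 * M)%N by rewrite prednK// muln_gt0.
have Mn : (M <= n.+1)%N by rewrite nE leq_pmull.
have n0n : (n0 <= n)%N by rewrite -ltnS; apply: leq_trans Mn; rewrite ltnS leq_addr.
have gN : 2 <= gam * n.+1%:R.
  rewrite mulrC -ler_pdivrMr//; apply: le_trans (ltW (archi_boundP _)) _.
    by rewrite divr_ge0// ltW.
  by rewrite ler_nat; apply: leq_trans Mn; rewrite ltnW// ltnS leq_addl.
have [G0 G0U] := gridU n n0n.
pose G : rel 'I_n.+1 := fun a b => G0 a b && G0 b a.
have Gsym : symmetric G by move=> a b; rewrite /G andbC.
have UG : area (U `+` gridset G) <= delta.
  apply: le_trans (@symmetrize_grid R n G0 U mU _) _.
    by move=> z; exact: superlevel_sym.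
  by rewrite mulrC -ler_pdivlMr.
have few : map_density R (clique_maps G k.+2 [set: 'I_n.+1]%SET) <= (gam / 2) ^+ k.+2.
  have d0 : 0 <= map_density R (clique_maps G k.+2 [set: 'I_n.+1]%SET) by rewrite divr_ge0.
  rewrite -(@ler_pXn2r _ (2 ^ m)) ?nnegrE ?expn_gt0//; last exact: ltW.
  have eta1 : eta <= 1 by apply: le_trans eta_eps (le_trans eps_al al1).
  apply: le_trans (clique_density_le_hom f proper eta0 G eta1) _.
  rewrite -/omega [omega]splitr; apply: lerD.
    by rewrite ler_pdivrMl ?exprn_gt0.
  by apply: le_trans cdelta; apply: ler_wpM2l.
set q := area (gridset (R := R) G).
have qE : q = (n.+1%:R ^+ 2)^-1 * pair_count R G by exact: area_gridset.
have qle := edge_density_le nE Gsym gam0 gN few.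
rewrite -qE -/r rgam in qle.
have mG : measurable (gridset (R := R) G) by exact: measurable_gridset.
have aU : area U <= q + area (U `+` gridset G).
  apply: area_le2 => //; first exact: measurable_setY.
  move=> z Uz; have [Gz|nG] := pselect (gridset G z); first by left.
  by right; left.
have dev := energy_deviation beta f (ltW eta0).
rewrite -/l -/U -/lb in dev; set J := energy beta f in dev *.
set S := \int[mu2]_(z in Sq) _ in dev.
have S0 : 0 <= S by apply: Rintegral_ge0 => z _; rewrite mulr_ge0// sqr_ge0.
have lU : l * area U <= l * q + l * eps.
  by rewrite -mulrDr ler_pM2l//; apply: le_trans aU _; rewrite lerD2l;
    exact: le_trans UG delta_eps.
have lq : l * q <= l * (1 - r^-1) + l * eps.
  by rewrite -mulrDr ler_pM2l.
set A := l * (1 - r^-1) in lq *; set B := l * eps in lU lq kappa.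
have B0 : 0 < B by rewrite mulr_gt0.
have -> : 3 * l * eps = 3 * B by rewrite /B mulrA.
have lqE : l * (q + 2 * eps) = l * q + 2 * B by rewrite /B; ring.
move: (l * area U) (l * q) (lb * _) dev lU lq kappa lqE => aU' q' k' dev lU lq kappa lqE.
split; first lra.
move=> Jge.
have S24 : S <= 24 * B by lra.
have qge : 1 - r^-1 - 2 * eps <= q.
  have : A <= l * (q + 2 * eps).
    by rewrite lqE; lra.
  by rewrite /A ler_pM2l// -lerBlDr.
rewrite qE in qge.
have [s sP] := near_extremal nE Gsym gam0 gN few al0 qge.
rewrite -/r rgam in sP.
exists (perm_mpbij R s).
apply: le_trans (cut_dist_turan beta f nE G s (ltW eta0) al0) _.
rewrite -/U -/S.
have a1 : al^-1 * S <= 24 * (l * al).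
  rewrite ler_pdivrMl//; apply: le_trans S24 _.
  by rewrite /B /eps expr2 le_eqVlt; apply/orP; left; apply/eqP; ring.
have a2 : (2 * eps + eps) / al = 3 * al.
  by rewrite /eps; field; rewrite gt_eqF.
rewrite a2 in sP.
have dm := UG; move: a1 sP eta_eps delta_eps eps_al dm.
set x1 := al^-1 * S; set x2 := area _; set x3 := _ * pair_count _ _.
have -> : (2 * r + 24 * l + 18) * al = 2 * (r * al) + 24 * (l * al) + 18 * al by ring.
move: (r * al) (l * al) => x4 x5.
lra.
Qed.

Lemma hom_density_ge0 m (H : sgraph m) f : 0 <= hom_density H f.
Proof.
apply: cube_int_ge0 => t It; apply: prodr_ge0 => e _.
by have /andP[] := graphon_itv f (It e.1) (It e.2).
Qed.

(** The competitor that bounds psi from below. *)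
Section turan_step.
Variables (k : nat).

Let st (z : R * R) : R := (cell k z.1 != cell k z.2)%:R.

Let st_meas : measurable_fun Sq st.
Proof.
by have [] := @bdd_meas_step _ _ R Sq _ (@cell2 R k) (fun c => (c.1 != c.2)%:R)
  (@measurable_cell2 R k).
Qed.

Let st_sym x y : I01 x -> I01 y -> st (x, y) = st (y, x).
Proof. by move=> _ _; rewrite /st eq_sym. Qed.

Let st_itv x y : I01 x -> I01 y -> 0 <= st (x, y) <= 1.
Proof. by move=> _ _; rewrite /st ler0n /= lern1 leq_b1. Qed.

(** Equal to the Turan graphon except on the lines x = 1 and y = 1, where the latter
    uses one colour more.  With exactly k + 1 colours, copies of H are excluded at
    every point, not only almost everywhere. *)
Definition multipartite : graphon R := Graphon st_meas st_sym st_itv.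

Variable beta : R.
Let h := gscale (edge_prob_itv beta) multipartite.

Lemma energy_multipartite : energy beta h = tilt_max beta * (1 - k.+1%:R^-1).
Proof.
have -> : energy beta h = \int[mu2]_(z in Sq)
    (if cell k z.1 != cell k z.2 then tilt_max beta else 0).
  apply: eq_Rintegral => z _; rewrite /h /= /st.
  by case: (_ != _); rewrite ?mulr1 ?mulr0 ?tilt_edge_prob ?tilt0.
rewrite (Rint_cell2 (fun a b : 'I_k.+1 => if a != b then tilt_max beta else 0)).
have r0 : k.+1%:R != 0 :> R by rewrite pnatr_eq0.
transitivity ((k.+1%:R ^+ 2)^-1 * \sum_(a < k.+1) (k%:R * tilt_max beta)).
  congr (_ * _); apply: eq_bigr => a _.
  rewrite -big_mkcond sumr_const mulr_natl; congr (_ *+ _).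
  rewrite (eq_card (B := predC1 a)); first by rewrite cardC1 card_ord.
  by move=> b; rewrite !inE unfold_in eq_sym.
rewrite sumr_const card_ord -[_ *+ k.+1]mulr_natl -[k.+1%:R in RHS]natr1 -natr1.
have r1 : k%:R + 1 != 0 :> R by rewrite natr1.
by field.
Qed.

Lemma hom_density_multipartite m (H : sgraph m) : ~~ colorable H k.+1 -> hom_density H
  h = 0.
Proof.
move=> ncol; rewrite -[RHS](@cube_int_cst R m 0).
apply: eq_cube_int => t _; apply/eqP; rewrite prodf_seq_eq0; apply/hasP.
have [c cP] : exists c : {ffun 'I_m -> 'I_k.+1}, c = [ffun i => cell k (tnth t i)] by
  eexists.
move: ncol; rewrite /colorable negb_exists => /forallP/(_ c).
rewrite negb_forall => /existsP[i]; rewrite negb_forall => /existsP[j].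
rewrite negb_imply negbK cP !ffunE => /andP[Hij /eqP cij].
have [ij|ji|e] := ltngtP i j; last first.
- by move: Hij; rewrite (val_inj e) adj_irrefl.
- exists (j, i); first by rewrite mem_index_enum.
  by rewrite /= ji adj_sym Hij /h /= /st /= cij eqxx mulr0.
- exists (i, j); first by rewrite mem_index_enum.
  by rewrite /= ij Hij /h /= /st /= cij eqxx mulr0.
Qed.

End turan_step.

End main.

Theorem theorem7p1 (R : realType) (m : nat) (H : sgraph m)
    (Hedge : exists i j, H i j) (beta1 : R) :
  let chi : R := (chromatic_number H)%:R in
  let p : R := edge_prob beta1 in
  let pg : graphon R := gscale (edge_prob_itv beta1) (turan chi) in
  (sup [set delta_box C (cls pg) | C in Fstar H beta1 beta2]
     @[beta2 --> -oo] --> (0 : R)) /\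
  (psi H beta1 beta2 @[beta2 --> -oo]
     --> (chi - 2) / (2 * (chi - 1)) * ln (1 / (1 - p))).
Proof.
have [k chiE] : exists k, chromatic_number H = k.+2.
  rewrite /chromatic_number; case: ex_minnP => -[|[|k]] colH _; last by exists k.
  - have [i [j Hij]] := Hedge; case/existsP: colH => c _.
    by case: (c i).
  - have [i [j Hij]] := Hedge; case/existsP: colH => c /forallP/(_ i)/forallP/(_ j).
    by rewrite Hij /= (ord1 (c i)) (ord1 (c j)) eqxx.
have [col proper] : exists col : 'I_m -> 'I_k.+2, forall i j, H i j -> col i != col j.
  move: chiE; rewrite /chromatic_number; case: ex_minnP => c /existsP[col colP] _ e.
  subst c; exists col => i j Hij; have /forallP/(_ i)/forallP/(_ j) := colP.
  by rewrite Hij.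
have ncol : ~~ colorable H k.+1.
  apply/negP => colH; move: chiE; rewrite /chromatic_number; case: ex_minnP => c _ cmin e.
  by have := cmin _ colH; rewrite e ltnn.
rewrite chiE => chi p pg.
pose l := tilt_max beta1; have l0 : 0 < l by exact: tilt_max_gt0.
pose limit := l * (1 - k.+1%:R^-1).
have r0 : 0 < k.+1%:R :> R by rewrite ltr0n.
have limitE : (chi - 2) / (2 * (chi - 1)) * ln (1 / (1 - p)) = limit.
  rewrite /limit /l /tilt_max -/p (_ : chi = k.+1%:R + 1); last by rewrite natr1.
  by field; rewrite nat1r gt_eqF.
have limit_ge0 : 0 <= limit.
  by rewrite mulr_ge0 ?(ltW l0)// subr_ge0 invf_le1// ler1n.
pose h0 := gscale (edge_prob_itv beta1) (multipartite R k).
have h0E beta2 : Tfun H beta1 beta2 h0 - Ifun h0 = limit.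
  by rewrite Tfun_sub_Ifun energy_multipartite hom_density_multipartite// mulr0 addr0.
(* Once beta2 < - l / tau, a graphon of homomorphism density above tau has
   T - I < 0 <= limit, so the competitors are those of few_homs_structure. *)
have regime (al : R) : 0 < al <= 1 -> \forall beta2 \near -oo,
    (forall f : graphon R, Tfun H beta1 beta2 f - Ifun f <= limit + 3 * l * al ^+ 2) /\
    (forall f : graphon R, limit <= Tfun H beta1 beta2 f - Ifun f ->
      exists s : mpbij R, cut_dist f (gact pg s) <= (2 * k.+1%:R + 24 * l + 18) * al).
  move=> al01; have [tau tau0 tauP] := few_homs_structure beta1 proper al01.
  near=> beta2.
  have b0 : beta2 < 0 by near: beta2; apply: nbhs_ninfty_lt; exact: num_real.
  have btau : beta2 < - (l / tau) by near: beta2; apply: nbhs_ninfty_lt; exact: num_real.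
  have many f : tau < hom_density H f -> Tfun H beta1 beta2 f - Ifun f < 0.
    move=> tf; rewrite Tfun_sub_Ifun; have := energy_le_tilt_max beta1 f; rewrite -/l => el.
    have : beta2 * tau < - l by rewrite -ltr_pdivlMr// mulNr.
    have : beta2 * hom_density H f <= beta2 * tau by rewrite ler_nM2l// ltW.
    move: el; set x := beta2 * tau; set y := beta2 * _; set z := energy _ _; lra.
  have le_energy f : Tfun H beta1 beta2 f - Ifun f <= energy beta1 f.
    by rewrite Tfun_sub_Ifun gerDl mulr_le0_ge0 ?hom_density_ge0// ltW.
  split=> f.
    have [tf|/many/ltW tf] := leP (hom_density H f) tau.
      by have [h _] := tauP f tf; exact: le_trans (le_energy f) h.
    by apply: le_trans tf _; rewrite addr_ge0// mulr_ge0 ?sqr_ge0// mulr_ge0// ltW.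
  move=> fmax; have [tf|/many tf] := leP (hom_density H f) tau; last first.
    by have := le_lt_trans limit_ge0 (le_lt_trans fmax tf); rewrite ltxx.
  by have [_ h] := tauP f tf; apply: h; exact: le_trans fmax (le_energy f).
split.
  apply/cvgrPdist_le => e e0.
  pose K := 2 * k.+1%:R + 24 * l + 18.
  have K0 : 0 < K by rewrite /K; lra.
  have al01 : 0 < Num.min 1 (e / K) <= 1 by rewrite lt_min ltr01 divr_gt0//= ge_min lexx.
  have := regime _ al01; apply: filterS => beta2 [_ close].
  set X := [set _ | _ in _]; rewrite sub0r normrN.
  have Xe x : X x -> 0 <= x <= e.
    move=> [_ [f fmax <-] <-]; rewrite delta_box_cls.
    have [s sP] := close f ltac:(by rewrite -(h0E beta2); exact: fmax).
    have lb : lbound [set cut_dist f (gact pg s) | s in [set: mpbij R]] 0.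
      by move=> _ [s' _ <-]; exact: cut_dist_ge0.
    apply/andP; split.
      by apply: lb_le_inf => //; exists (cut_dist f (gact pg s)); exists s.
    apply: le_trans (_ : cut_dist f (gact pg s) <= _).
      by apply: ge_inf; [exists 0|exists s].
    apply: le_trans sP _; rewrite -/K mulrC -ler_pdivlMr//.
    by rewrite ge_min lexx orbT.
  have [->|/set0P[x Xx]] := eqVneq X set0; first by rewrite sup0 normr0 ltW.
  have ubX : ubound X e by move=> y /Xe /andP[].
  rewrite ger0_norm; first by apply: ge_sup => //; exists x.
  have /andP[x0 _] := Xe x Xx; apply: le_trans x0 _.
  by apply: ub_le_sup => //; exists e.
rewrite limitE; apply/cvgrPdist_le => e e0.
pose K := 3 * l.
have K0 : 0 < K by rewrite /K; lra.
have al01 : 0 < Num.min 1 (e / K) <= 1 by rewrite lt_min ltr01 divr_gt0//= ge_min lexx.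
have := regime _ al01; apply: filterS => beta2 [upper_bound _].
set al := Num.min 1 (e / K) in al01 upper_bound.
have ale : 3 * l * al ^+ 2 <= e.
  have /andP[a0 a1] := al01.
  apply: le_trans (_ : K * al <= _).
    by rewrite /K ler_pM2l// expr2 ler_piMl// ltW.
  by rewrite mulrC -ler_pdivlMr// ge_min lexx orbT.
have ub : ubound [set Tfun H beta1 beta2 h - Ifun h | h in [set: graphon R]] (limit + e).
  by move=> _ [f _ <-]; apply: le_trans (upper_bound f) _; rewrite lerD2l.
have psi_le : psi H beta1 beta2 <= limit + e.
  by apply: ge_sup => //; exists (Tfun H beta1 beta2 h0 - Ifun h0); exists h0.
have le_psi : limit <= psi H beta1 beta2.
  by rewrite -(h0E beta2); apply: ub_le_sup; [exists (limit + e)|exists h0].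
by rewrite ler_norml; move: psi_le le_psi; lra.
Unshelve. all: by end_near.
Qed.
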